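(* Let $S_{\mathbb{Q}}$ be the smooth del Pezzo surface of degree $1$ over $\mathbb{Q}$ given by $$ S_{\mathbb{Q}}=\Big\{y^2=x^3+uv^2(3u-v)x+\frac14uv\bigl(4v^4-23uv^3-18u^2v^2+u^3v-4u^4\bigr)\Big\}\subset \mathbb{P}_{\mathbb{Q}}(1_u,1_v,2_x,3_y). $$ Then there is a dominant rational map $\mathbb{P}^2_{\mathbb{Q}}\dashrightarrow S_{\mathbb{Q}}$ of degree $9$ defined over $\mathbb{Q}$.
   Context: $\mathbb{P}_{\mathbb{Q}}(1_u,1_v,2_x,3_y)$ denotes the weighted projective space over $\mathbb{Q}$ with homogeneous coordinates $u,v,x,y$ of weights $1,1,2,3$, respectively. A del Pezzo surface of degree $1$ over a field is a smooth projective geometrically integral surface $S$ with $-K_S$ ample and $(-K_S)^2=1$. *)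

(* Defs.v *)
From HB Require Import structures.
Set Warnings "-notation-overridden,-ambiguous-paths,-notation-incompatible-prefix,-abstract-large-number".
From mathcomp Require Import all_boot all_order all_algebra all_field.
From mathcomp Require Export mpoly.
From mathcomp Require Import ring.

Set Implicit Arguments.
Unset Strict Implicit.
Unset Printing Implicit Defensive.

Import GRing.Theory Num.Theory.
Local Open Scope ring_scope.

Definition iu : 'I_4 := @Ordinal 4 0 isT.
Definition iv : 'I_4 := @Ordinal 4 1 isT.
Definition ix : 'I_4 := @Ordinal 4 2 isT.
Definition iy : 'I_4 := @Ordinal 4 3 isT.

Definition weight (i : 'I_4) : nat := nth 0%N [:: 1; 1; 2; 3]%N i.

Definition wdeg (m : 'X_{1..4}) : nat := (\sum_(i < 4) m i * weight i)%N.

Lemma wdeg0 : wdeg 0%MM = 0%N.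
Proof. by rewrite /wdeg big1 // => i _; rewrite mnm0E. Qed.

Lemma wdegD : {morph wdeg : m1 m2 / (m1 + m2)%MM >-> (m1 + m2)%N}.
Proof.
move=> m1 m2; rewrite /wdeg -big_split /=.
by apply: eq_bigr => i _; rewrite mnmDE mulnDl.
Qed.

HB.instance Definition _ := isMeasure.Build 4 wdeg wdeg0 wdegD.

(* G (p) for G with rational coefficients and p a vector of algebraic numbers *)
Definition geval (n : nat) (G : {mpoly rat[n]}) (p : 'I_n -> algC) : algC :=
  (map_mpoly ratr G).@[p].

(* Representatives of the geometric points of {F = 0} in P(1,1,2,3); two
   vectors are representatives of the same point when they differ by
   p_i |-> c ^ weight i * p_i, which does not affect the predicates below. *)
Definition geom_point (F : {mpoly rat[4]}) (p : 'I_4 -> algC) : Prop :=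
  (exists i, p i != 0) /\ geval F p = 0.

(* The first condition says that the stabilizer of p in G_m (the roots of unity
   of order the gcd below) is trivial: the surface avoids the singular points
   [0:0:1:0] and [0:0:0:1] of P(1,1,2,3).  Elsewhere, smoothness is the
   Jacobian criterion on the affine cone over the surface. *)
Definition smooth_in_P1123 (F : {mpoly rat[4]}) : Prop :=
  forall p, geom_point F p ->
    \big[gcdn/0%N]_(i < 4 | p i != 0) weight i = 1%N
    /\ exists i, geval F^`M(i) p != 0.

(* A smooth sextic in P(1,1,2,3) has -K = O(1), by adjunction, and
   K^2 = 6 / (1 * 1 * 2 * 3) = 1: it is a del Pezzo surface of degree 1. *)
Record dP1_sextic := DP1Sextic {
  eqn :> {mpoly rat[4]};
  eqn_homog : eqn \is 6.-homog for wdeg;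
  eqn_smooth : smooth_in_P1123 eqn }.

Definition vanishes_on (S : dP1_sextic) (G : {mpoly rat[4]}) : Prop :=
  forall p, geom_point S p -> geval G p = 0.

(* A rational map P^2 --> S over rat, represented by forms
   [f_u : f_v : f_x : f_y] of degrees d, d, 2d, 3d which satisfy the equation of
   S.  Clearing denominators, every rational map to S has such a
   representative; common factors of the f_i are allowed. *)
Record ratmap (S : dP1_sextic) := RatMap {
  rm_forms :> 4.-tuple {mpoly rat[3]};
  rm_deg : nat;
  rm_homog : forall i, tnth rm_forms i \is (rm_deg * weight i).-homog;
  rm_nonzero : exists i, tnth rm_forms i != 0;
  rm_eqn : S \mPo rm_forms = 0 }.

Definition rm_at (S : dP1_sextic) (f : ratmap S) (p : 'I_3 -> algC) :
    'I_4 -> algC := fun i => geval (tnth f i) p.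

(* The image of f is Zariski dense in S: every hypersurface section of S which
   contains f (p), for all p at which the representative is defined, is S. *)
Definition dominant (S : dP1_sextic) (f : ratmap S) : Prop :=
  forall (e : nat) (G : {mpoly rat[4]}), G \is e.-homog for wdeg ->
    (forall p, (exists i, rm_at f p i != 0) -> geval G (rm_at f p) = 0) ->
    vanishes_on S G.

(* The function field of P^2, inside the fraction field of rat[X_0, X_1, X_2] *)
Definition funfield_P2 (z : {fraction {mpoly rat[3]}}) : Prop :=
  exists (e : nat) (g h : {mpoly rat[3]}),
    [/\ g \is e.-homog, h \is e.-homog, h != 0
      & z = FracField.tofrac g / FracField.tofrac h].

(* The image of f^* : rat(S) -> rat(P^2), for f dominant: the rational functions
   on S are the quotients G / H of forms of the same weighted degree with H not
   identically zero on S, and f^* (G / H) = G (f) / H (f). *)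
Definition pullback_funfield (S : dP1_sextic) (f : ratmap S)
    (z : {fraction {mpoly rat[3]}}) : Prop :=
  exists (e : nat) (G H : {mpoly rat[4]}),
    [/\ G \is e.-homog for wdeg, H \is e.-homog for wdeg, ~ vanishes_on S H
      & z = FracField.tofrac (G \mPo f) / FracField.tofrac (H \mPo f)].

(* [K : k] = n, for subfields k and K of E with k contained in K *)
Definition ext_degree (E : fieldType) (k K : E -> Prop) (n : nat) : Prop :=
  exists b : 'I_n -> E,
    (forall i, K (b i)) /\
    (forall z, K z -> exists! c : {ffun 'I_n -> E},
       (forall i, k (c i)) /\ z = \sum_(i < n) c i * b i).

Definition ratmap_degree (S : dP1_sextic) (f : ratmap S) (n : nat) : Prop :=
  ext_degree (pullback_funfield f) funfield_P2 n.

Definition S_eqn : {mpoly rat[4]} :=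
  let u := 'X_iu in let v := 'X_iv in let x := 'X_ix in let y := 'X_iy in
  y ^+ 2 - (x ^+ 3 + u * v ^+ 2 * (3 *: u - v) * x
            + (1 / 4) *: (u * v * (4 *: v ^+ 4 - 23 *: (u * v ^+ 3)
                - 18 *: (u ^+ 2 * v ^+ 2) + u ^+ 3 * v - 4 *: u ^+ 4))).

Lemma S_eqn_homog : S_eqn \is 6.-homog for wdeg.
Proof.
have hX i : ('X_i : {mpoly rat[4]}) \is (weight i).-homog for wdeg.
  rewrite dhomogX /= /wdeg (bigD1 i) //= big1 => [|j ne_ji].
    by rewrite addn0 mnm1E eqxx mul1n.
  by rewrite mnm1E eq_sym (negPf ne_ji).
have hM k l m (p q : {mpoly rat[4]}) : p \is k.-homog for wdeg ->
    q \is l.-homog for wdeg -> (k + l)%N = m -> p * q \is m.-homog for wdeg.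
  by move=> hp hq <-; apply: dhomogM.
have hE k n m (p : {mpoly rat[4]}) : p \is k.-homog for wdeg ->
    (k * n)%N = m -> p ^+ n \is m.-homog for wdeg.
  by move=> hp <-; apply: dhomogMn.
rewrite /S_eqn.
move: (hX iu) (hX iv) (hX ix) (hX iy); rewrite /weight /=.
move: ('X_iu) ('X_iv) ('X_ix) ('X_iy) => u v x y hu hv hx hy.
have huv := hM _ _ 2 _ _ hu hv erefl.
apply: rpredB; first exact: (hE _ _ _ _ hy).
apply: rpredD; first apply: rpredD.
- exact: (hE _ _ _ _ hx).
- apply: (hM 4 2 6)%N => //.
  apply: (hM 3 1 4)%N => //.
    exact: (hM 1 2 3 _ _ hu (hE 1 2 2 _ hv erefl)).
  by apply: rpredB => //; apply: rpredZ.
apply/rpredZ/(hM _ _ 6 _ _ huv) => //.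
apply: rpredB; last exact/rpredZ/(hE _ _ _ _ hu).
apply: rpredD; last exact: (hM _ _ _ _ _ (hE 1 3 3 _ hu erefl) hv).
apply: rpredB; last first.
  exact/rpredZ/(hM _ _ _ _ _ (hE 1 2 2 _ hu erefl) (hE 1 2 2 _ hv erefl)).
apply: rpredB; first exact/rpredZ/(hE _ _ _ _ hv).
exact/rpredZ/(hM _ _ _ _ _ hu (hE 1 3 3 _ hv erefl)).
Qed.

Lemma gevalD n (p q : {mpoly rat[n]}) a :
  geval (p + q) a = geval p a + geval q a.
Proof. by rewrite /geval rmorphD mevalD. Qed.

Lemma gevalN n (p : {mpoly rat[n]}) a : geval (- p) a = - geval p a.
Proof. by rewrite /geval rmorphN mevalN. Qed.

Lemma gevalM n (p q : {mpoly rat[n]}) a :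
  geval (p * q) a = geval p a * geval q a.
Proof. by rewrite /geval rmorphM mevalM. Qed.

Lemma gevalZ n c (p : {mpoly rat[n]}) a : geval (c *: p) a = ratr c * geval p a.
Proof. by rewrite /geval map_mpolyZ mevalZ. Qed.

Lemma gevalXU n i a : geval ('X_i : {mpoly rat[n]}) a = a i.
Proof. by rewrite /geval map_mpolyX mevalXU. Qed.

Lemma geval_nat n (k : nat) a : geval (k%:R : {mpoly rat[n]}) a = k%:R.
Proof. by rewrite /geval !rmorph_nat. Qed.

Lemma mderivXU n (i j : 'I_n) : ('X_j : {mpoly rat[n]})^`M(i) = (j == i)%:R.
Proof.
rewrite mderivX mnm1E; case: eqP => [->|_]; last by rewrite scale0r.
rewrite scale1r -mpolyX0; congr mpolyX.
by apply/mnmP=> k; rewrite mnmBE subnn mnm0E.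
Qed.

(* Value and i-th partial derivative at p *)
Definition jet (p : 'I_4 -> algC) (i : 'I_4) (q : {mpoly rat[4]}) (a b : algC) :=
  geval q p = a /\ geval q^`M(i) p = b.

Lemma jetU p i j : jet p i 'X_j (p j) (j == i)%:R.
Proof. by split; rewrite ?mderivXU ?gevalXU ?geval_nat. Qed.

Lemma jetD p i q r a b a' b' :
  jet p i q a b -> jet p i r a' b' -> jet p i (q + r) (a + a') (b + b').
Proof. by move=> [<- <-] [<- <-]; split; rewrite ?mderivD gevalD. Qed.

Lemma jetB p i q r a b a' b' :
  jet p i q a b -> jet p i r a' b' -> jet p i (q - r) (a - a') (b - b').
Proof. by move=> [<- <-] [<- <-]; split; rewrite ?mderivB gevalD gevalN. Qed.

Lemma jetM p i q r a b a' b' :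
  jet p i q a b -> jet p i r a' b' -> jet p i (q * r) (a * a') (b * a' + a * b').
Proof. by move=> [<- <-] [<- <-]; split; rewrite ?mderivM ?gevalD !gevalM. Qed.

Lemma jetZ p i c q a b : jet p i q a b -> jet p i (c *: q) (ratr c * a) (ratr c * b).
Proof. by move=> [<- <-]; split; rewrite ?mderivZ gevalZ. Qed.

Lemma jetX p i n q a b : jet p i q a b ->
  jet p i (q ^+ n.+1) (a ^+ n.+1) ((n.+1)%:R * a ^+ n * b).
Proof.
move=> jq; elim: n => [|n IHn]; first by rewrite !expr1 expr0 !mul1r.
have [val der] := jetM jq IHn.
split; rewrite [q ^+ _]exprS ?val ?der; first by rewrite -exprS.
by rewrite [a ^+ n.+1]exprS -[(n.+2)%:R]natr1; move: (a ^+ n) => an; ring.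
Qed.

Lemma S_eqn_jet (p : 'I_4 -> algC) (i : 'I_4) :
  let u := p iu in let v := p iv in let x := p ix in let y := p iy in
  jet p i S_eqn
    (y ^+ 2 - (x ^+ 3 + u * v ^+ 2 * (3 * u - v) * x
      + 1 / 4 * (u * v * (4 * v ^+ 4 - 23 * (u * v ^+ 3) - 18 * (u ^+ 2 * v ^+ 2)
                          + u ^+ 3 * v - 4 * u ^+ 4))))
    ((iy == i)%:R * (2 * y) - (ix == i)%:R * (3 * x ^+ 2 + u * v ^+ 2 * (3 * u - v))
     - (iu == i)%:R * (v ^+ 2 * (6 * u - v) * x
         + 1 / 4 * (4 * v ^+ 5 - 46 * u * v ^+ 4 - 54 * u ^+ 2 * v ^+ 3
                    + 4 * u ^+ 3 * v ^+ 2 - 20 * u ^+ 4 * v))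
     - (iv == i)%:R * ((6 * u ^+ 2 * v - 3 * u * v ^+ 2) * x
         + 1 / 4 * (u * (20 * v ^+ 4 - 92 * (u * v ^+ 3) - 54 * (u ^+ 2 * v ^+ 2)
                         + 2 * u ^+ 3 * v - 4 * u ^+ 4)))).
Proof.
move=> u v x y.
have jq a b a' b' : jet p i S_eqn a b -> a = a' -> b = b' -> jet p i S_eqn a' b'.
  by move=> ? <- <-.
have ju : jet p i 'X_iu u (iu == i)%:R by exact: jetU.
have jv : jet p i 'X_iv v (iv == i)%:R by exact: jetU.
have jx : jet p i 'X_ix x (ix == i)%:R by exact: jetU.
have jy : jet p i 'X_iy y (iy == i)%:R by exact: jetU.
apply: jq.
- apply: (jetB (jetX 1 jy)); apply: jetD.
    exact: (jetD (jetX 2 jx)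
             (jetM (jetM (jetM ju (jetX 1 jv)) (jetB (jetZ 3 ju) jv)) jx)).
  apply/jetZ/(jetM (jetM ju jv)).
  exact: (jetB (jetD (jetB (jetB (jetZ 4 (jetX 3 jv)) (jetZ 23 (jetM ju (jetX 2 jv))))
                 (jetZ 18 (jetM (jetX 1 ju) (jetX 1 jv)))) (jetM (jetX 2 ju) jv))
            (jetZ 4 (jetX 3 ju))).
- by rewrite fmorph_div rmorph1 !rmorph_nat.
- rewrite fmorph_div rmorph1 !rmorph_nat.
  move: (_ == i)%:R (_ == i)%:R (_ == i)%:R (_ == i)%:R => dy dx du dv.
  by field.
Qed.

(* Eliminating x from the equations for a singular point of S with y = 0 gives
   two binary forms in u, v, without common zero for v <> 0: the certificate is
   the extended Euclidean algorithm. *)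
Lemma S_eqn_elim (u v : algC) :
  let a := u * v ^+ 2 * (3 * u - v) in
  let a_u := v ^+ 2 * (6 * u - v) in
  let b4 := u * v * (4 * v ^+ 4 - 23 * (u * v ^+ 3) - 18 * (u ^+ 2 * v ^+ 2)
              + u ^+ 3 * v - 4 * u ^+ 4) in
  let b4_u := 4 * v ^+ 5 - 46 * u * v ^+ 4 - 54 * u ^+ 2 * v ^+ 3
              + 4 * u ^+ 3 * v ^+ 2 - 20 * u ^+ 4 * v in
  3 * b4_u ^+ 2 + 16 * a * a_u ^+ 2 = 0 ->
  3 * b4 * a_u - 2 * a * b4_u = 0 -> v = 0.
Proof.
move=> a a_u b4 b4_u P1 P2.
pose A := 444728750499745881777842584%N%:R * v ^+ 5
         - 3288715893718845764355933364%N%:R * u * v ^+ 4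
         + 29073914067507344932496529399%N%:R * u ^+ 2 * v ^+ 3
         - 644820507341473762449649097%N%:R * u ^+ 3 * v ^+ 2
         + 5027502527188578118741654198%N%:R * u ^+ 4 * v
         - 7274600243738660380731997584%N%:R * u ^+ 5.
pose B := - 163988640864554996070067123888%N%:R * v ^+ 7
         + 833174550559060029363785909040%N%:R * u * v ^+ 6
         + 2119041724342698025110451042476%N%:R * u ^+ 2 * v ^+ 5
         + 1355412221226671497986624227172%N%:R * u ^+ 3 * v ^+ 4
         + 657310438515464248174868098416%N%:R * u ^+ 4 * v ^+ 3
         + 987488031561565505630881772784%N%:R * u ^+ 5 * v ^+ 2
         - 69612519634228945867065540240%N%:R * u ^+ 6 * v
         + 181865006093466509518299939600%N%:R * u ^+ 7.
pose c : algC := 2 ^+ 7 * 3 * 7 ^+ 2 * 239 ^+ 2 * 1733 * (37 * 1000 + 159)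
                 * (555 * 1000 + 361) ^+ 2.
have : c * v ^+ 16 = A * v * (3 * b4_u ^+ 2 + 16 * a * a_u ^+ 2)
                     + B * (3 * b4 * a_u - 2 * a * b4_u).
  by rewrite /A /B /c /a /a_u /b4 /b4_u; ring.
rewrite P1 P2 !mulr0 addr0 => /eqP; rewrite mulf_eq0 expf_eq0 /=.
case/orP=> [|/eqP //]; apply/contraTeq => _; rewrite /c.
have nz k : (k.+1)%:R != 0 :> algC by rewrite pnatr_eq0.
have nzM a1 a2 : a1 != 0 -> a2 != 0 -> a1 * a2 != 0 :> algC by apply: mulf_neq0.
have nzX a1 k : a1 != 0 -> a1 ^+ k != 0 :> algC by apply: expf_neq0.
have nzD k l m : k%:R * l%:R + (m.+1)%:R != 0 :> algC.
  by rewrite -natrM -natrD addnS.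
have nzD1 := nzD 37 1000 158; have nzD2 := nzD 555 1000 360.
exact: (nzM _ _ (nzM _ _ (nzM _ _ (nzM _ _ (nzM _ _ (nzM _ _ (nzX _ 7%N (nz 1%N))
  (nz 2%N)) (nzX _ 2%N (nz 6%N))) (nzX _ 2%N (nz 238))) (nz 1732)) nzD1)
  (nzX _ 2%N nzD2)).
Qed.

Lemma S_eqn_smooth : smooth_in_P1123 S_eqn.
Proof.
move=> p [p_neq0 Sp].
pose u := p iu; pose v := p iv; pose x := p ix; pose y := p iy.
have p0 : u = 0 -> v = 0 -> x = 0 -> y = 0 -> False.
  move=> u0 v0 x0 y0; case: p_neq0 => -[[|[|[|[|k]]]] lt_i4] /eqP pi_neq0 //;
    apply: pi_neq0.
  - by rewrite -[RHS]u0; congr p; apply: val_inj.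
  - by rewrite -[RHS]v0; congr p; apply: val_inj.
  - by rewrite -[RHS]x0; congr p; apply: val_inj.
  - by rewrite -[RHS]y0; congr p; apply: val_inj.
pose a := u * v ^+ 2 * (3 * u - v).
pose b4 := u * v * (4 * v ^+ 4 - 23 * (u * v ^+ 3) - 18 * (u ^+ 2 * v ^+ 2)
                    + u ^+ 3 * v - 4 * u ^+ 4).
have E : y ^+ 2 = x ^+ 3 + a * x + 1 / 4 * b4.
  have [+ _] := S_eqn_jet p iu; rewrite Sp => /esym/eqP.
  by rewrite subr_eq0 => /eqP <-.
split.
  have gcd1 i : p i != 0 -> weight i = 1%N ->
      \big[gcdn/0%N]_(j < 4 | p j != 0) weight j = 1%N.
    by move=> pi_neq0 w1; rewrite (bigD1 i) //= w1 gcd1n.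
  have [u0|] := eqVneq u 0; last by move=> u_neq0; apply: (gcd1 iu).
  have [v0|] := eqVneq v 0; last by move=> v_neq0; apply: (gcd1 iv).
  have {}E : y ^+ 2 = x ^+ 3 by rewrite E /a /b4 u0 v0; ring.
  have x_neq0 : x != 0.
    apply/eqP => x0; apply: p0 => //; apply/eqP.
    by rewrite -sqrf_eq0 E x0 expr0n.
  have y_neq0 : y != 0 by rewrite -sqrf_eq0 E expf_eq0.
  rewrite (bigD1 ix x_neq0) (bigD1 iy) /=; last by rewrite y_neq0.
  exact: (etrans (gcdnA 2 3 _) (gcd1n _)).
have [/existsP //|/existsPn sing] := boolP [exists i, geval S_eqn^`M(i) p != 0].
exfalso.
have D i : geval S_eqn^`M(i) p = 0 by apply/eqP/negbNE/sing.
pose a_u := v ^+ 2 * (6 * u - v).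
pose b4_u := 4 * v ^+ 5 - 46 * u * v ^+ 4 - 54 * u ^+ 2 * v ^+ 3
             + 4 * u ^+ 3 * v ^+ 2 - 20 * u ^+ 4 * v.
have Dy : 2 * y = 0.
  by have [_] := S_eqn_jet p iy; rewrite D !mul0r !subr0 mul1r => <-.
have Dx : 3 * x ^+ 2 + a = 0.
  have [_] := S_eqn_jet p ix; rewrite D !mul0r !subr0 sub0r => /esym/eqP.
  by rewrite [(ix == ix)%:R * _]mul1r oppr_eq0 => /eqP.
have Du : a_u * x + 1 / 4 * b4_u = 0.
  have [_] := S_eqn_jet p iu; rewrite D !mul0r !subr0 sub0r => /esym/eqP.
  by rewrite [(iu == iu)%:R * _]mul1r oppr_eq0 => /eqP.
have Dv : (6 * u ^+ 2 * v - 3 * u * v ^+ 2) * x + 1 / 4 * (u * (20 * v ^+ 4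
    - 92 * (u * v ^+ 3) - 54 * (u ^+ 2 * v ^+ 2) + 2 * u ^+ 3 * v - 4 * u ^+ 4)) = 0.
  have [_] := S_eqn_jet p iv; rewrite D !mul0r !subr0 sub0r => /esym/eqP.
  by rewrite [(iv == iv)%:R * _]mul1r oppr_eq0 => /eqP.
have y0 : y = 0 by move/eqP: Dy; rewrite mulf_eq0 pnatr_eq0 => /eqP.
have v0 : v = 0.
  have b4_uE : b4_u = - 4 * (a_u * x).
    have -> : b4_u = 4 * (a_u * x + 1 / 4 * b4_u) - 4 * (a_u * x) by field.
    by rewrite Du; ring.
  have b4E : b4 = - 4 * (x ^+ 3 + a * x).
    have -> : b4 = 4 * (x ^+ 3 + a * x + 1 / 4 * b4) - 4 * (x ^+ 3 + a * x).
      by field.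
    by rewrite -E y0; ring.
  apply: (S_eqn_elim (u := u)); rewrite -/a -/a_u -/b4 -/b4_u b4_uE.
    transitivity (16 * a_u ^+ 2 * (3 * x ^+ 2 + a)); first by ring.
    by rewrite Dx mulr0.
  rewrite b4E; transitivity (- 4 * a_u * x * (3 * x ^+ 2 + a)); first by ring.
  by rewrite Dx mulr0.
have x0 : x = 0.
  have /eqP : 3 * x ^+ 2 = 0 by rewrite -[RHS]Dx /a v0; ring.
  by rewrite mulf_eq0 pnatr_eq0 sqrf_eq0 => /eqP.
have u0 : u = 0.
  have /eqP : u ^+ 5 = 0.
    by apply: oppr_inj; rewrite oppr0 -[RHS]Dv v0 x0; field.
  by rewrite expf_eq0 => /eqP.
exact: p0.
Qed.

Definition S_Q : dP1_sextic := DP1Sextic S_eqn_homog S_eqn_smooth.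

(* Main.v *)
From HB Require Import structures.
Require Import Defs.
From mathcomp Require Import all_boot all_order all_algebra all_field.
From mathcomp Require Import ring zify.

Set Implicit Arguments.
Unset Strict Implicit.
Unset Printing Implicit Defensive.

Import GRing.Theory Num.Theory.
Local Open Scope ring_scope.

(** The pencil of plane cubics u F + v G spanned by the cuspidal cubics
    F = Y^2 Z - X^3 and G = Y^3 + Z^3 + X Y^2 - Y Z^2 has the elliptic fibration
    (u : v) on S, with the point [0 : 0 : 1 : 1] blown up, as its Jacobian.  Through
    a general point p of the plane passes one cubic of the pencil, that of parameter
    (u : v) = (G (p) : - F (p)), and sending p to the class of 3 p minus a line
    section is a map to the Jacobian which has degree 9 on every cubic.  By the
    classical invariant theory of ternary cubics, this map is given by covariants:
    with the Hessian H, the covariant T of degree 8 and order 6, and the Jacobian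
    determinant J of the cubic, H and T, one has x = - T / H^2 and y = J / (6 H^3).
    The Weierstrass equation is [jac_sqr].  It follows from the value at H, T of the
    adjugate form of the Hessian matrix ([adjq_hess_theta], [adjq_theta_theta]),
    because the square of J is a Gram determinant ([det3_sqr]).

    Let k be the function field of S, embedded in that of the plane, K.  That
    [K : k] is at least 9 is seen modulo 3 ([basis_form_indep]).  There H becomes
    v^3 Y^3, and for the order in Y, then in X, the leading monomials of u, v, x, y
    show that the values of k in Z^2 all lie in 3 Z^2, while those of the 9
    functions X^r Y^s with r, s <= 2 (for Z = 1) represent all the classes modulo
    3 Z^2: hence these functions are independent.  Taking only one of them gives
    that no form vanishes on the image unless it vanishes on S, which is dominance.

    That [K : k] is at most 9 is a dimension count over the field k0 of functions of
    u / v ([ten_forms_dependent]).  The functions on S with a pole of order at most N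
    along the zero section have dimension N over k0.  Multiplied by H^N they become
    forms of degree 3 N on the generic cubic of the pencil, where the forms of
    degree 3 N + c have dimension 9 N + O(1) ([span]).  So 10 elements of K cannot
    be independent: there would be 10 N independent products in that space. *)

(** * Covariants of the pencil of cubics *)

Section SymmetricForm.

Variables (R : comNzRingType) (a b c d e : R).

(** The adjugate of the symmetric matrix A with rows (a, e, 0), (e, b, d) and
    (0, d, c), as a bilinear form. *)
Definition adj_form (k1 k2 k3 l1 l2 l3 : R) : R :=
  k1 * l1 * (b * c - d ^+ 2) + k2 * l2 * (a * c) + k3 * l3 * (a * b - e ^+ 2)
  - (k1 * l2 + k2 * l1) * (e * c) + (k1 * l3 + k3 * l1) * (e * d)
  - (k2 * l3 + k3 * l2) * (a * d).

Definition det3 (k1 k2 k3 l1 l2 l3 m1 m2 m3 : R) : R :=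
  k1 * (l2 * m3 - l3 * m2) - k2 * (l1 * m3 - l3 * m1) + k3 * (l1 * m2 - l2 * m1).

(** For p = (p, q, r), the square of det (A p, k, l) times that of det A is the Gram
    determinant of these three vectors for the adjugate form.  As A p pairs with w
    to det A * (p . w), the factor det A ^ 2 cancels, and when p is isotropic for A
    the terms of degree 2 in the pairings of k and l drop out. *)
Lemma det3_sqr (p q r k1 k2 k3 l1 l2 l3 : R) :
  p * (a * p + e * q) + q * (e * p + b * q + d * r) + r * (d * q + c * r) = 0 ->
  let pk := p * k1 + q * k2 + r * k3 in
  let pl := p * l1 + q * l2 + r * l3 in
  det3 (a * p + e * q) (e * p + b * q + d * r) (d * q + c * r) k1 k2 k3 l1 l2 l3 ^+ 2
  = 2 * pk * pl * adj_form k1 k2 k3 l1 l2 l3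
    - pk ^+ 2 * adj_form l1 l2 l3 l1 l2 l3 - pl ^+ 2 * adj_form k1 k2 k3 k1 k2 k3.
Proof.
move=> isotropic pk pl.
pose m1 := k2 * l3 - k3 * l2; pose m2 := k3 * l1 - k1 * l3.
pose m3 := k1 * l2 - k2 * l1.
rewrite -[RHS]addr0 -(mulr0 (m1 * (a * m1 + e * m2)
  + m2 * (e * m1 + b * m2 + d * m3) + m3 * (d * m2 + c * m3))) -isotropic.
by rewrite /m1 /m2 /m3 /pk /pl /det3 /adj_form; ring.
Qed.

End SymmetricForm.

Section Covariants.

Variables (R : comNzRingType) (u v X Y Z : R).

Definition cubic : R :=
  u * (Y ^+ 2 * Z - X ^+ 3) + v * (Y ^+ 3 + Z ^+ 3 + X * Y ^+ 2 - Y * Z ^+ 2).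

Definition cubic_X := - 3 * u * X ^+ 2 + v * Y ^+ 2.
Definition cubic_Y := 2 * u * Y * Z + v * (3 * Y ^+ 2 + 2 * X * Y - Z ^+ 2).
Definition cubic_Z := u * Y ^+ 2 + v * (3 * Z ^+ 2 - 2 * Y * Z).

(** Half the second derivatives of [cubic]; the one in X and Z vanishes. *)
Definition q_XX := - 3 * (u * X).
Definition q_YY := u * Z + 3 * (v * Y) + v * X.
Definition q_ZZ := 3 * (v * Z) - v * Y.
Definition q_YZ := u * Y - v * Z.
Definition q_XY := v * Y.

Definition hess := q_XX * (q_YY * q_ZZ - q_YZ ^+ 2) - q_XY ^+ 2 * q_ZZ.

Definition adjq := adj_form q_XX q_YY q_ZZ q_YZ q_XY.

(** One third of the gradient of [hess], and its derivatives. *)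
Definition hess_X := u ^+ 3 * Y ^+ 2 - u ^+ 2 * v * Y * Z - 3 * u ^+ 2 * v * Z ^+ 2
  + 2 * u * v ^+ 2 * X * Y - 6 * u * v ^+ 2 * X * Z + 3 * u * v ^+ 2 * Y ^+ 2
  - 9 * u * v ^+ 2 * Y * Z + u * v ^+ 2 * Z ^+ 2.
Definition hess_Y := 2 * u ^+ 3 * X * Y - u ^+ 2 * v * X * Z + u * v ^+ 2 * X ^+ 2
  + 6 * u * v ^+ 2 * X * Y - 9 * u * v ^+ 2 * X * Z + v ^+ 3 * Y ^+ 2
  - 2 * v ^+ 3 * Y * Z.
Definition hess_Z := - u ^+ 2 * v * X * Y - 6 * u ^+ 2 * v * X * Z
  - 3 * u * v ^+ 2 * X ^+ 2 - 9 * u * v ^+ 2 * X * Y + 2 * u * v ^+ 2 * X * Z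
  - v ^+ 3 * Y ^+ 2.

Definition hess_XX := 2 * u * v ^+ 2 * Y - 6 * u * v ^+ 2 * Z.
Definition hess_XY := 2 * u ^+ 3 * Y - u ^+ 2 * v * Z + 2 * u * v ^+ 2 * X
  + 6 * u * v ^+ 2 * Y - 9 * u * v ^+ 2 * Z.
Definition hess_XZ := - u ^+ 2 * v * Y - 6 * u ^+ 2 * v * Z - 6 * u * v ^+ 2 * X
  - 9 * u * v ^+ 2 * Y + 2 * u * v ^+ 2 * Z.
Definition hess_YY := 2 * u ^+ 3 * X + 6 * u * v ^+ 2 * X + 2 * v ^+ 3 * Y
  - 2 * v ^+ 3 * Z.
Definition hess_YZ := - u ^+ 2 * v * X - 9 * u * v ^+ 2 * X - 2 * v ^+ 3 * Y.
Definition hess_ZZ := - 6 * u ^+ 2 * v * X + 2 * u * v ^+ 2 * X.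

(** The covariant of degree 8 and order 6 of a ternary cubic: its Hessian matrix
    bordered by the gradient of the Hessian. *)
Definition theta := adjq hess_X hess_Y hess_Z hess_X hess_Y hess_Z.

(** A partial derivative of [theta], by the product rule; a, b, c, d, e are the
    derivatives of the entries of the symmetric matrix and l that of the vector. *)
Definition theta_deriv (a b c d e l1 l2 l3 : R) : R :=
  hess_X ^+ 2 * (b * q_ZZ + q_YY * c - 2 * q_YZ * d)
  + hess_Y ^+ 2 * (a * q_ZZ + q_XX * c)
  + hess_Z ^+ 2 * (a * q_YY + q_XX * b - 2 * q_XY * e)
  - 2 * hess_X * hess_Y * (e * q_ZZ + q_XY * c)
  + 2 * hess_X * hess_Z * (e * q_YZ + q_XY * d)
  - 2 * hess_Y * hess_Z * (a * q_YZ + q_XX * d)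
  + 2 * adjq hess_X hess_Y hess_Z l1 l2 l3.

Definition theta_X := theta_deriv (- 3 * u) v 0 0 0 hess_XX hess_XY hess_XZ.
Definition theta_Y := theta_deriv 0 (3 * v) (- v) u v hess_XY hess_YY hess_YZ.
Definition theta_Z := theta_deriv 0 u (3 * v) (- v) 0 hess_XZ hess_YZ hess_ZZ.

(** The covariant of degree 12 and order 9: the Jacobian determinant of [cubic],
    [hess] and [theta]. *)
Definition jac := det3 cubic_X cubic_Y cubic_Z hess_X hess_Y hess_Z
                       theta_X theta_Y theta_Z.

(** The invariants of the cubic, or the Weierstrass coefficients of S, the second
    one multiplied by 4. *)
Definition coef4 := u * v ^+ 2 * (3 * u - v).
Definition coef6 := u * v * (4 * v ^+ 4 - 23 * (u * v ^+ 3) - 18 * (u ^+ 2 * v ^+ 2)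
                             + u ^+ 3 * v - 4 * u ^+ 4).

(* The cubic in X is solved for the multiple u X^3 of the leading power, so that
   [ring] can reduce to a normal form modulo the equation of the curve. *)
Let cubic_eq0_rewrite : cubic = 0 ->
  u * X ^+ 3 = u * (Y ^+ 2 * Z) + v * (Y ^+ 3 + Z ^+ 3 + X * Y ^+ 2 - Y * Z ^+ 2).
Proof. by move=> C0; rewrite -[LHS]addr0 -C0 /cubic; ring. Qed.

(** The pairing is a covariant, so on the curve it is a polynomial in the
    invariants, [hess] and [theta]; its degree 13 and order 9 leave one monomial. *)
Lemma adjq_hess_theta : cubic = 0 ->
  adjq hess_X hess_Y hess_Z theta_X theta_Y theta_Z = - 7 * coef4 * hess ^+ 3.
Proof.
move=> /cubic_eq0_rewrite C0.
rewrite /theta_X /theta_Y /theta_Z /theta_deriv /adjq /adj_form /hess /coef4.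
rewrite /hess_XX /hess_XY /hess_XZ /hess_YY /hess_YZ /hess_ZZ /hess_X /hess_Y /hess_Z.
rewrite /q_XX /q_YY /q_ZZ /q_YZ /q_XY.
ring: C0.
Qed.

(** Here the degree 18 and order 12 leave two monomials. *)
Lemma adjq_theta_theta : cubic = 0 ->
  adjq theta_X theta_Y theta_Z theta_X theta_Y theta_Z
  = - 48 * coef4 * theta * hess ^+ 2 - 9 * coef6 * hess ^+ 4.
Proof.
move=> /cubic_eq0_rewrite C0.
rewrite /theta_X /theta_Y /theta_Z /theta_deriv /theta /adjq /adj_form /hess /coef4 /coef6.
rewrite /hess_XX /hess_XY /hess_XZ /hess_YY /hess_YZ /hess_ZZ /hess_X /hess_Y /hess_Z.
rewrite /q_XX /q_YY /q_ZZ /q_YZ /q_XY.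
ring: C0.
Qed.

Lemma euler_hess : X * hess_X + Y * hess_Y + Z * hess_Z = hess.
Proof.
by rewrite /hess_X /hess_Y /hess_Z /hess /q_XX /q_YY /q_ZZ /q_YZ /q_XY; ring.
Qed.

Lemma euler_theta : X * theta_X + Y * theta_Y + Z * theta_Z = 6 * theta.
Proof.
have EX : X * hess_XX + Y * hess_XY + Z * hess_XZ = 2 * hess_X.
  by rewrite /hess_XX /hess_XY /hess_XZ /hess_X; ring.
have EY : X * hess_XY + Y * hess_YY + Z * hess_YZ = 2 * hess_Y.
  by rewrite /hess_XY /hess_YY /hess_YZ /hess_Y; ring.
have EZ : X * hess_XZ + Y * hess_YZ + Z * hess_ZZ = 2 * hess_Z.
  by rewrite /hess_XZ /hess_YZ /hess_ZZ /hess_Z; ring.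
rewrite /theta_X /theta_Y /theta_Z /theta_deriv /theta /adjq /adj_form.
move: EX EY EZ.
move: hess_XX hess_XY hess_XZ hess_YY hess_YZ hess_ZZ => kXX kXY kXZ kYY kYZ kZZ.
move: hess_X hess_Y hess_Z => k1 k2 k3 EX EY EZ.
transitivity (2 * adjq k1 k2 k3 (X * kXX + Y * kXY + Z * kXZ)
      (X * kXY + Y * kYY + Z * kYZ) (X * kXZ + Y * kYZ + Z * kZZ)
    + 2 * adjq k1 k2 k3 k1 k2 k3).
  by rewrite /adjq /adj_form /q_XX /q_YY /q_ZZ /q_YZ /q_XY; ring.
by rewrite EX EY EZ /adjq /adj_form; ring.
Qed.

(** The point (X, Y, Z) is isotropic for the Hessian matrix, which maps it to the
    gradient of [cubic], and by Euler it pairs with the gradients of [hess] and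
    [theta] to multiples of these: so [det3_sqr] applies.  Divided by hess^6, this
    is the Weierstrass equation at x = - theta / hess^2, y = jac / (6 hess^3). *)
Lemma jac_sqr : cubic = 0 ->
  jac ^+ 2 = 9 * (- 4 * theta ^+ 3 - 4 * coef4 * theta * hess ^+ 4
                  + coef6 * hess ^+ 6).
Proof.
move=> C0.
have cX : cubic_X = q_XX * X + q_XY * Y by rewrite /cubic_X /q_XX /q_XY; ring.
have cY : cubic_Y = q_XY * X + q_YY * Y + q_YZ * Z.
  by rewrite /cubic_Y /q_XY /q_YY /q_YZ; ring.
have cZ : cubic_Z = q_YZ * Y + q_ZZ * Z by rewrite /cubic_Z /q_YZ /q_ZZ; ring.
have isotropic : X * cubic_X + Y * cubic_Y + Z * cubic_Z = 0.
  transitivity (3 * cubic); last by rewrite C0 mulr0.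
  by rewrite /cubic_X /cubic_Y /cubic_Z /cubic; ring.
rewrite /jac cX cY cZ det3_sqr -?cX -?cY -?cZ // euler_hess euler_theta -/adjq.
rewrite -/theta adjq_hess_theta // adjq_theta_theta //.
by move: coef4 coef6 hess theta => *; ring.
Qed.

End Covariants.

(** * The rational map *)

(** Degree in the parameters u, v of the pencil and degree in the coordinates X, Y, Z
    are used for two gradings of the covariants: homogeneity of forms, and their
    effect on a filtration.  Both are families Q of predicates compatible with the
    ring operations. *)
Section Bigraded.

Variables (R : comNzRingType) (Q : nat -> nat -> R -> Prop).
Hypothesis Q1 : Q 0 0 1.
Hypothesis QN : forall d m p, Q d m p -> Q d m (- p).
Hypothesis QD : forall d m p q, Q d m p -> Q d m q -> Q d m (p + q).
Hypothesis QM : forall d m d' m' p q,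
  Q d m p -> Q d' m' q -> Q (d + d') (m + m') (p * q).

Let Qnat n : Q 0 0 n.+1%:R.
Proof. by elim: n => // n IHn; rewrite -natr1; apply: QD. Qed.

Let Q0 : Q 0 0 0.
Proof. by rewrite -(subrr 1); apply/QD/QN. Qed.

Let QX d m n p : Q d m p -> Q (d * n) (m * n) (p ^+ n).
Proof.
move=> Qp; elim: n => [|n IHn]; first by rewrite !muln0 expr0.
by rewrite !mulnS exprS; apply: QM.
Qed.

Let QMe d m d1 m1 d2 m2 p q : Q d1 m1 p -> Q d2 m2 q ->
  (d1 + d2)%N = d -> (m1 + m2)%N = m -> Q d m (p * q).
Proof. by move=> Qp Qq <- <-; apply: QM. Qed.

Let QXe d m d1 m1 n p : Q d1 m1 p -> (d1 * n)%N = d -> (m1 * n)%N = m ->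
  Q d m (p ^+ n).
Proof. by move=> Qp <- <-; apply: QX. Qed.

Variables (u v X Y Z : R).
Hypotheses (Qu : Q 1 0 u) (Qv : Q 1 0 v).
Hypotheses (QX1 : Q 0 1 X) (QY1 : Q 0 1 Y) (QZ1 : Q 0 1 Z).

(* Degrees are inferred from the leaves upwards: those of a product are left as
   unification variables until its factors have been graded. *)
Ltac grade := first
  [ exact: Qu | exact: Qv | exact: QX1 | exact: QY1 | exact: QZ1 | exact: Qnat
  | eassumption
  | apply: QN; grade
  | apply: QD; grade
  | eapply QXe; [grade | reflexivity | reflexivity]
  | eapply QMe; [grade | grade | reflexivity | reflexivity] ].

Lemma bigraded_hess : Q 3 3 (hess u v X Y Z).
Proof. by rewrite /hess /q_XX /q_YY /q_ZZ /q_YZ /q_XY; grade. Qed.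

Lemma bigraded_hess_X : Q 3 2 (hess_X u v X Y Z).
Proof. by rewrite /hess_X; grade. Qed.

Lemma bigraded_hess_Y : Q 3 2 (hess_Y u v X Y Z).
Proof. by rewrite /hess_Y; grade. Qed.

Lemma bigraded_hess_Z : Q 3 2 (hess_Z u v X Y Z).
Proof. by rewrite /hess_Z; grade. Qed.

Let QqXX : Q 1 1 (q_XX u X). Proof. by rewrite /q_XX; grade. Qed.
Let QqYY : Q 1 1 (q_YY u v X Y Z). Proof. by rewrite /q_YY; grade. Qed.
Let QqZZ : Q 1 1 (q_ZZ v Y Z). Proof. by rewrite /q_ZZ; grade. Qed.
Let QqYZ : Q 1 1 (q_YZ u v Y Z). Proof. by rewrite /q_YZ; grade. Qed.
Let QqXY : Q 1 1 (q_XY v Y). Proof. by rewrite /q_XY; grade. Qed.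

Lemma bigraded_theta : Q 8 6 (theta u v X Y Z).
Proof.
have := bigraded_hess_X; have := bigraded_hess_Y; have := bigraded_hess_Z.
by rewrite /theta /adjq /adj_form => *; grade.
Qed.

Let bigraded_theta_grad : [/\ Q 8 5 (theta_X u v X Y Z), Q 8 5 (theta_Y u v X Y Z)
                            & Q 8 5 (theta_Z u v X Y Z)].
Proof.
have := bigraded_hess_X; have := bigraded_hess_Y; have := bigraded_hess_Z.
have : Q 3 1 (hess_XX u v Y Z) by rewrite /hess_XX; grade.
have : Q 3 1 (hess_XY u v X Y Z) by rewrite /hess_XY; grade.
have : Q 3 1 (hess_XZ u v X Y Z) by rewrite /hess_XZ; grade.
have : Q 3 1 (hess_YY u v X Y Z) by rewrite /hess_YY; grade.
have : Q 3 1 (hess_YZ u v X Y) by rewrite /hess_YZ; grade.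
have : Q 3 1 (hess_ZZ u v X) by rewrite /hess_ZZ; grade.
rewrite /theta_X /theta_Y /theta_Z /theta_deriv /adjq /adj_form.
rewrite !(mul0r, mulr0, add0r, addr0, subr0, sub0r) => *.
by split; grade.
Qed.

Lemma bigraded_jac : Q 12 9 (jac u v X Y Z).
Proof.
have := bigraded_hess_X; have := bigraded_hess_Y; have := bigraded_hess_Z.
have [QtX QtY QtZ] := bigraded_theta_grad.
have : Q 1 2 (cubic_X u v X Y) by rewrite /cubic_X; grade.
have : Q 1 2 (cubic_Y u v X Y Z) by rewrite /cubic_Y; grade.
have : Q 1 2 (cubic_Z u v Y Z) by rewrite /cubic_Z; grade.
by rewrite /jac /det3 => *; grade.
Qed.

End Bigraded.

Section Forms.

Variables (R : comNzRingType) (X Y Z : R).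

Definition cusp_F : R := Y ^+ 2 * Z - X ^+ 3.
Definition cusp_G : R := Y ^+ 3 + Z ^+ 3 + X * Y ^+ 2 - Y * Z ^+ 2.

Let h := hess cusp_G (- cusp_F) X Y Z.

(** The point (u, v, x, y) over the parameter (G : - F) of the curve through
    (X, Y, Z), with weights scaled by 2 hess to clear denominators; the last
    coordinate is 4 / 3 of [form_jac]. *)
Definition form_u : R := 2 * cusp_G * h.
Definition form_v : R := - 2 * cusp_F * h.
Definition form_x : R := - 4 * theta cusp_G (- cusp_F) X Y Z.
Definition form_jac : R := jac cusp_G (- cusp_F) X Y Z.

Lemma cubic_through_point : cubic cusp_G (- cusp_F) X Y Z = 0.
Proof. by rewrite /cubic /cusp_G /cusp_F; ring. Qed.

Lemma forms_on_S y : 3 * y = 4 * form_jac ->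
  36 * y ^+ 2 = 9 * (4 * form_x ^+ 3 + 4 * coef4 form_u form_v * form_x
                     + coef6 form_u form_v).
Proof.
move=> yE; transitivity (4 * (3 * y) ^+ 2); first by ring.
rewrite yE exprMn /form_jac (jac_sqr cubic_through_point) -/h.
rewrite /form_u /form_v /form_x /coef4 /coef6.
by move: cusp_F cusp_G h theta => F G H t; ring.
Qed.

Section Bigraded.

Variable Q : nat -> nat -> R -> Prop.
Hypothesis Q1 : Q 0 0 1.
Hypothesis QN : forall d m p, Q d m p -> Q d m (- p).
Hypothesis QD : forall d m p q, Q d m p -> Q d m q -> Q d m (p + q).
Hypothesis QM : forall d m d' m' p q,
  Q d m p -> Q d' m' q -> Q (d + d') (m + m') (p * q).
Hypotheses (QF : Q 1 0 cusp_F) (QG : Q 1 0 cusp_G).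
Hypotheses (QX : Q 0 1 X) (QY : Q 0 1 Y) (QZ : Q 0 1 Z).

Let Qh : Q 3 3 h. Proof. by apply: bigraded_hess => //; apply: QN. Qed.

Let Q2 : Q 0 0 2. Proof. exact: (QD Q1 Q1). Qed.

Lemma bigraded_form_u : Q 4 3 form_u.
Proof. exact: (QM (QM Q2 QG) Qh). Qed.

Lemma bigraded_form_v : Q 4 3 form_v.
Proof. exact: (QM (QM (QN Q2) QF) Qh). Qed.

Lemma bigraded_form_x : Q 8 6 form_x.
Proof.
have Q4 : Q 0 0 4.
  have -> : 4 = 2 * 2 :> R by ring.
  exact: (QM Q2 Q2).
by apply: (QM (QN Q4)); apply: bigraded_theta => //; apply: QN.
Qed.

Lemma bigraded_form_jac : Q 12 9 form_jac.
Proof. by apply: bigraded_jac => //; apply: QN. Qed.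

End Bigraded.

End Forms.

Lemma rmorph_forms (R S : comNzRingType) (phi : {rmorphism R -> S}) (X Y Z : R) :
  [/\ phi (form_u X Y Z) = form_u (phi X) (phi Y) (phi Z),
      phi (form_v X Y Z) = form_v (phi X) (phi Y) (phi Z),
      phi (form_x X Y Z) = form_x (phi X) (phi Y) (phi Z)
    & phi (form_jac X Y Z) = form_jac (phi X) (phi Y) (phi Z)].
Proof.
have FE : phi (cusp_F X Y Z) = cusp_F (phi X) (phi Y) (phi Z).
  by rewrite /cusp_F; ring.
have GE : phi (cusp_G X Y Z) = cusp_G (phi X) (phi Y) (phi Z).
  by rewrite /cusp_G; ring.
have hE u v : phi (hess u v X Y Z) = hess (phi u) (phi v) (phi X) (phi Y) (phi Z).
  by rewrite /hess /q_XX /q_YY /q_ZZ /q_YZ /q_XY; ring.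
have hX u v : phi (hess_X u v X Y Z) = hess_X (phi u) (phi v) (phi X) (phi Y) (phi Z).
  by rewrite /hess_X; ring.
have hY u v : phi (hess_Y u v X Y Z) = hess_Y (phi u) (phi v) (phi X) (phi Y) (phi Z).
  by rewrite /hess_Y; ring.
have hZ u v : phi (hess_Z u v X Y Z) = hess_Z (phi u) (phi v) (phi X) (phi Y) (phi Z).
  by rewrite /hess_Z; ring.
have aE u v k1 k2 k3 l1 l2 l3 : phi (adjq u v X Y Z k1 k2 k3 l1 l2 l3)
    = adjq (phi u) (phi v) (phi X) (phi Y) (phi Z)
        (phi k1) (phi k2) (phi k3) (phi l1) (phi l2) (phi l3).
  by rewrite /adjq /adj_form /q_XX /q_YY /q_ZZ /q_YZ /q_XY; ring.
have tE u v : phi (theta u v X Y Z) = theta (phi u) (phi v) (phi X) (phi Y) (phi Z).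
  by rewrite /theta aE hX hY hZ.
have dE u v a b c d e l1 l2 l3 : phi (theta_deriv u v X Y Z a b c d e l1 l2 l3)
    = theta_deriv (phi u) (phi v) (phi X) (phi Y) (phi Z)
        (phi a) (phi b) (phi c) (phi d) (phi e) (phi l1) (phi l2) (phi l3).
  rewrite /theta_deriv -hX -hY -hZ -aE /q_XX /q_YY /q_ZZ /q_YZ /q_XY.
  by move: (adjq _ _ _ _ _) (hess_X _ _ _ _ _) (hess_Y _ _ _ _ _) (hess_Z _ _ _ _ _)
    => A k1 k2 k3; ring.
have nE : phi (- cusp_F X Y Z) = - cusp_F (phi X) (phi Y) (phi Z).
  by rewrite rmorphN FE.
split; first by rewrite /form_u 2!rmorphM rmorph_nat hE nE GE.
- by rewrite /form_v 2!rmorphM rmorphN rmorph_nat hE nE GE FE.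
- by rewrite /form_x rmorphM rmorphN rmorph_nat tE nE GE.
rewrite /form_jac -nE -GE; move: (cusp_G X Y Z) (- cusp_F X Y Z) => u v.
have tX : phi (theta_X u v X Y Z)
        = theta_X (phi u) (phi v) (phi X) (phi Y) (phi Z).
  rewrite /theta_X dE rmorph0 /hess_XX /hess_XY /hess_XZ.
  by congr (theta_deriv _ _ _ _ _ _ _ _ _ _ _ _ _); ring.
have tY : phi (theta_Y u v X Y Z)
        = theta_Y (phi u) (phi v) (phi X) (phi Y) (phi Z).
  rewrite /theta_Y dE rmorph0 /hess_XY /hess_YY /hess_YZ.
  by congr (theta_deriv _ _ _ _ _ _ _ _ _ _ _ _ _); ring.
have tZ : phi (theta_Z u v X Y Z)
        = theta_Z (phi u) (phi v) (phi X) (phi Y) (phi Z).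
  rewrite /theta_Z dE rmorph0 /hess_XZ /hess_YZ /hess_ZZ.
  by congr (theta_deriv _ _ _ _ _ _ _ _ _ _ _ _ _); ring.
rewrite /jac -tX -tY -tZ -hX -hY -hZ /det3 /cubic_X /cubic_Y /cubic_Z.
by move: (theta_X _ _ _ _ _) (theta_Y _ _ _ _ _) (theta_Z _ _ _ _ _)
  (hess_X _ _ _ _ _) (hess_Y _ _ _ _ _) (hess_Z _ _ _ _ _) => t1 t2 t3 k1 k2 k3; ring.
Qed.

(** * Leading monomials modulo 3 *)

Definition i0 : 'I_3 := @Ordinal 3 0 isT.
Definition i1 : 'I_3 := @Ordinal 3 1 isT.
Definition i2 : 'I_3 := @Ordinal 3 2 isT.

(** Modulo 3 the Hessian is v^3 Y^3: the nine flexes of every curve of the pencil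
    collapse onto the line Y = 0. *)
Lemma hess_mod3 (R : comNzRingType) (u v X Y Z : R) : 3 = 0 :> R ->
  hess u v X Y Z = v ^+ 3 * Y ^+ 3.
Proof.
move=> R3; rewrite -[RHS]addr0 -(mul0r (u ^+ 3 * X * Y ^+ 2 - u ^+ 2 * v * X * Y * Z
  - 3 * u ^+ 2 * v * X * Z ^+ 2 + u * v ^+ 2 * X ^+ 2 * Y
  - 3 * u * v ^+ 2 * X ^+ 2 * Z + 3 * u * v ^+ 2 * X * Y ^+ 2
  - 9 * u * v ^+ 2 * X * Y * Z + u * v ^+ 2 * X * Z ^+ 2 - v ^+ 3 * Y ^+ 2 * Z)) -R3.
by rewrite /hess /q_XX /q_YY /q_ZZ /q_YZ /q_XY; ring.
Qed.

Lemma form_x_mod3 (R : comNzRingType) (X Z : R) : 3 = 0 :> R ->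
  form_x X 0 Z = X ^+ 18 * Z ^+ 12.
Proof.
move=> R3; rewrite /form_x.
have -> : cusp_G X 0 Z = Z ^+ 3 by rewrite /cusp_G; ring.
have -> : - cusp_F X 0 Z = X ^+ 3 by rewrite /cusp_F; ring.
set u := Z ^+ 3; set v := X ^+ 3.
rewrite /theta /adjq /adj_form.
have -> : q_XX u X = 0 by rewrite /q_XX R3; ring.
have -> : q_ZZ v 0 Z = 0 by rewrite /q_ZZ R3; ring.
have -> : q_XY v 0 = 0 by rewrite /q_XY; ring.
have -> : hess_X u v X 0 Z = u * v ^+ 2 * Z ^+ 2.
  have -> : hess_X u v X 0 Z = u * v ^+ 2 * Z ^+ 2
    - 3 * (u ^+ 2 * v * Z ^+ 2 + 2 * u * v ^+ 2 * X * Z) by rewrite /hess_X; ring.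
  by rewrite R3; ring.
transitivity (X ^+ 18 * Z ^+ 12 + 3 * (X ^+ 18 * Z ^+ 12)); last first.
  by rewrite R3 mul0r addr0.
rewrite /q_YZ /u /v.
by move: (hess_Y _ _ _ _ _) (hess_Z _ _ _ _ _) => *; ring.
Qed.

Local Notation L := {poly {poly 'F_3}}.

Lemma L3 : 3 = 0 :> L.
Proof. by rewrite -!polyC_natr (pchar_Fp_0 (p := 3)). Qed.

Definition XL : L := 'X%:P.
Definition YL : L := 'X.

(** The pair (a, b) is the value of p for the valuation of rank 2 by the order in Y,
    then in X; for the forms at hand, the coefficient of Y^a is even a monomial. *)
Definition lead (a b : nat) (p : L) : Prop :=
  exists (q : L) (c : 'F_3), [/\ c != 0, p = q * 'X^a & q.[0] = c *: 'X^b].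

Lemma leadM a b a' b' p p' : lead a b p -> lead a' b' p' ->
  lead (a + a') (b + b') (p * p').
Proof.
move=> [q [c [c0 -> q0]]] [q' [c' [c'0 -> q'0]]].
exists (q * q'), (c * c'); split; first exact: mulf_neq0.
  by rewrite exprD; ring.
by rewrite hornerM q0 q'0 -scalerAl -scalerAr scalerA exprD.
Qed.

Lemma lead1 : lead 0 0 1.
Proof. by exists 1, 1; rewrite oner_neq0 mulr1 hornerC scale1r. Qed.

Lemma leadXn a b n p : lead a b p -> lead (a * n) (b * n) (p ^+ n).
Proof.
move=> lp; elim: n => [|n IHn]; first by rewrite !muln0; exact: lead1.
by rewrite !mulnS exprS; apply: leadM.
Qed.

Lemma lead_X : lead 0 1 XL.
Proof. by exists XL, 1; rewrite oner_neq0 mulr1 hornerC scale1r. Qed.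

Lemma lead_Y : lead 1 0 YL.
Proof. by exists 1, 1; rewrite oner_neq0 mul1r hornerC scale1r. Qed.

Lemma F3_poly3 : 3 = 0 :> {poly 'F_3}.
Proof. by rewrite -polyC_natr (pchar_Fp_0 (p := 3)). Qed.

Lemma lead_form_u : lead 3 9 (form_u XL YL 1).
Proof.
exists (2 * cusp_G XL YL 1 * (- cusp_F XL YL 1) ^+ 3), 2.
split=> //.
  by rewrite /form_u (hess_mod3 _ _ _ _ _ L3) /YL; ring.
rewrite /cusp_G /cusp_F !hornerE /= ?hornerE.
rewrite -[2 *: _]mul_polyC; ring.
Qed.

Lemma lead_form_v : lead 3 12 (form_v XL YL 1).
Proof.
exists (- 2 * cusp_F XL YL 1 * (- cusp_F XL YL 1) ^+ 3), 2.
split=> //.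
  by rewrite /form_v (hess_mod3 _ _ _ _ _ L3) /YL; ring.
rewrite /cusp_F !hornerE /= ?hornerE.
rewrite -[2 *: _]mul_polyC; ring.
Qed.

Lemma form_x_at0 : (form_x XL YL 1).[0] = 'X^18.
Proof.
have [_ _ xE _] := rmorph_forms (horner_eval (0 : {poly 'F_3})) XL YL 1.
rewrite -[LHS]/(horner_eval _ _) xE rmorph1 /= /horner_eval /XL /YL hornerC hornerX.
by rewrite (form_x_mod3 _ _ F3_poly3) expr1n mulr1.
Qed.

Lemma lead_form_x : lead 0 18 (form_x XL YL 1).
Proof.
by exists (form_x XL YL 1), 1; rewrite oner_neq0 mulr1 scale1r form_x_at0.
Qed.

Section IntegralJacobian.

Let P := {mpoly int[3]}.
Let X : P := 'X_i0.
Let Y : P := 'X_i1.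
Let Z : P := 'X_i2.

(** The square of [form_jac] is 9 times an integral form, so [form_jac] vanishes
    modulo 3: polynomials over a field have no zero divisors. *)
Lemma form_jac_div3 : exists J : P, form_jac X Y Z = 3 * J.
Proof.
set D := form_jac X Y Z.
have phiD : map_mpoly (intr : int -> 'F_3) D = 0.
  apply/eqP; rewrite -sqrf_eq0 -rmorphXn /= /D /form_jac.
  rewrite (jac_sqr (cubic_through_point _ _ _)) rmorphM rmorph_nat.
  have -> : 9%:R = ((3%:R : 'F_3) * 3%:R)%:MP_[3] by rewrite -natrM mpolyC_nat.
  by rewrite (pchar_Fp_0 (p := 3)) // mul0r mpolyC0 mul0r.
have D3 m : (3 %| D@_m)%Z.
  rewrite (dvdz_pcharf (pchar_Fp (p := 3) _)) //.
  by rewrite -mcoeff_map_mpoly phiD mcoeff0.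
exists (\sum_(m <- msupp D) (D@_m %/ 3)%Z *: 'X_[m]).
rewrite [LHS]mpolyE mulr_sumr; apply: eq_bigr => m _.
have -> : 3 = (3 : int)%:MP_[3] by rewrite -(mpolyC_nat 3 _ 3).
by rewrite mul_mpolyC scalerA mulrC divzK.
Qed.

(** Modulo 3 and Y the Weierstrass equation reduces to J^2 = x^3. *)
Lemma lead_jac_div3 (phi : {rmorphism P -> L}) (J : P) :
    phi X = XL -> phi Y = YL -> phi Z = 1 -> form_jac X Y Z = 3 * J ->
  lead 0 27 (phi J).
Proof.
move=> phiX phiY phiZ JE.
pose x := form_x X Y Z; pose h := hess (cusp_G X Y Z) (- cusp_F X Y Z) X Y Z.
pose a4 := coef4 (cusp_G X Y Z) (- cusp_F X Y Z).
pose a6 := coef6 (cusp_G X Y Z) (- cusp_F X Y Z).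
have J2 : 16 * J ^+ 2 = x ^+ 3 + h * (16 * a4 * x * h ^+ 3 + 16 * a6 * h ^+ 5).
  apply: (@mulfI _ 9); first by rewrite -(mpolyC_nat 3) mpolyC_eq0.
  transitivity (16 * (3 * J) ^+ 2); first by ring.
  rewrite -JE /form_jac (jac_sqr (cubic_through_point _ _ _)) -/h -/a4 -/a6.
  by rewrite /x /form_x; ring.
have phih : (phi h).[0] = 0.
  have -> : phi h = hess (phi (cusp_G X Y Z)) (phi (- cusp_F X Y Z)) XL YL 1.
    rewrite -phiX -phiY -phiZ /h; move: (cusp_G _ _ _) (- cusp_F _ _ _) => u v.
    by rewrite /hess /q_XX /q_YY /q_ZZ /q_YZ /q_XY; ring.
  by rewrite (hess_mod3 _ _ _ _ _ L3) hornerM hornerXn expr0n mulr0.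
have phix : (phi x).[0] = 'X^18.
  have [_ _ -> _] := rmorph_forms phi X Y Z.
  by rewrite phiX phiY phiZ form_x_at0.
pose g := (phi J).[0].
have g2 : g ^+ 2 = ('X^27) ^+ 2.
  have : 16 * phi J ^+ 2
         = phi x ^+ 3 + phi h * phi (16 * a4 * x * h ^+ 3 + 16 * a6 * h ^+ 5).
    have -> : 16 * phi J ^+ 2 = phi (16 * J ^+ 2) by ring.
    by rewrite J2; ring.
  move/(congr1 (horner_eval (0 : {poly 'F_3}))).
  rewrite [LHS]rmorphM rmorph_nat rmorphD [in X in _ + X]rmorphM /=.
  rewrite /horner_eval !horner_exp.
  rewrite phih phix mul0r addr0 -/g => g2.
  transitivity (16%:R * g ^+ 2 - 3 * (5 * g ^+ 2)); first by ring.
  by rewrite F3_poly3 mul0r subr0 g2; ring.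
have : (g - 'X^27) * (g + 'X^27) == 0 by rewrite -subr_sqr g2 subrr.
rewrite mulf_eq0 subr_eq0 addr_eq0 => /orP[] /eqP gE.
  by exists (phi J), 1; rewrite oner_neq0 mulr1 -/g scale1r.
by exists (phi J), (- 1); rewrite oppr_eq0 oner_neq0 mulr1 -/g scaleN1r.
Qed.

End IntegralJacobian.

Lemma lead_coefs a b p : lead a b p ->
  (forall k, (k < a)%N -> p`_k = 0) /\ exists2 c : 'F_3, c != 0 & p`_a = c *: 'X^b.
Proof.
move=> [q [c [c0 -> q0]]]; split=> [k ka|]; first by rewrite coefMXn ka.
by exists c => //; rewrite coefMXn ltnn subnn -horner_coef0 q0.
Qed.

(** Elements with distinct values are independent modulo 3. *)
Lemma lead_indep (I : finType) (c : I -> int) (p : I -> L) (a b : I -> nat) :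
    (forall i, c i != 0 -> lead (a i) (b i) (p i)) ->
    {in [pred i | c i != 0] &, injective (fun i => (a i, b i))} ->
    (exists i, ~~ (3 %| c i)%Z) ->
  \sum_i (c i)%:~R * p i != 0.
Proof.
move=> lead_p inj_ab [i3 ci3].
have [i0 ci0 min_a] := arg_minnP a (P := fun i => ~~ (3 %| c i)%Z) ci3.
have c3 i : (3 %| c i)%Z = ((c i)%:~R == 0 :> 'F_3).
  by rewrite (dvdz_pcharf (pchar_Fp (p := 3) _)).
have intrC (z : int) : z%:~R = (z%:~R : 'F_3)%:P%:P :> L by rewrite !rmorph_int.
have nz i : ~~ (3 %| c i)%Z -> c i != 0 by apply: contraNneq => ->; rewrite dvdz0.
have [_ [k k0 pk]] := lead_coefs (lead_p _ (nz _ ci0)).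
apply/eqP => /(congr1 (fun q : L => q`_(a i0)`_(b i0))).
rewrite (bigD1 i0) //= coefD coefD intrC coefCM coefCM pk coefZ coefXn eqxx mulr1.
rewrite coef_sum coef_sum big1 => [|i ne_i].
  rewrite addr0 !coef0 => /eqP; rewrite mulf_eq0 (negPf k0) orbF -c3.
  by rewrite (negPf ci0).
rewrite intrC coefCM coefCM; have [c3i|c3i] := boolP (3 %| c i)%Z.
  by move: c3i; rewrite c3 => /eqP ->; rewrite mul0r.
have [lt_a [k' _ pk']] := lead_coefs (lead_p _ (nz _ c3i)).
have := min_a i c3i; rewrite leq_eqVlt => /predU1P[eq_a|/lt_a ->].
  rewrite eq_a pk' coefZ coefXn; case: eqP => [eq_b|]; last by rewrite !mulr0.
  by rewrite (inj_ab i i0) ?eqxx ?inE ?nz // ?eq_a ?eq_b in ne_i.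
by rewrite coef0 mulr0.
Qed.

(** Clearing denominators, then dividing by 3 as long as possible. *)
Lemma primitive_multiple (I : finType) (c : I -> rat) : (exists i, c i != 0) ->
  exists (q : rat) (d : I -> int),
    (forall i, (d i)%:~R = q * c i) /\ exists i, ~~ (3 %| d i)%Z.
Proof.
move=> [j cj].
have descent n (d : I -> int) : (`|d j| <= n)%N -> d j != 0 ->
    exists (q : rat) (d' : I -> int),
      (forall i, (d' i)%:~R = q * (d i)%:~R) /\ exists i, ~~ (3 %| d' i)%Z.
  elim: n d => [|n IHn] d; first by rewrite leqn0 absz_eq0 => ->.
  move=> dj dj0; have [/existsP[i di]|] := boolP [exists i, ~~ (3 %| d i)%Z].
    by exists 1, d; split=> [k|]; [rewrite mul1r | exists i].
  rewrite negb_exists => /forallP d3.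
  have dE i : d i = (d i %/ 3)%Z * 3 by rewrite divzK //; apply/negbNE/d3.
  have [||q [d' [d'E ex]]] := IHn (fun i => (d i %/ 3)%Z).
  - have := dE j; move: dj dj0; move: (d j) (_ %/ 3)%Z => x y; lia.
  - by apply: contraNneq dj0 => y0; rewrite dE y0.
  exists (q / 3), d'; split=> // i; rewrite d'E [in RHS]dE rmorphM /=.
  by field.
pose D := \prod_i denq (c i).
have D0 : D%:~R != 0 :> rat.
  by rewrite intr_eq0; apply/prodf_neq0 => i _; apply: denq_neq0.
pose d i := numq (c i) * \prod_(k | k != i) denq (c k).
have dE i : (d i)%:~R = D%:~R * c i.
  by rewrite /d /D [in RHS](bigD1 i) //= !rmorphM /= numqE; ring.
have dj : d j != 0 by rewrite -(intr_eq0 rat) dE mulf_neq0.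
have [q [d' [d'E ex]]] := descent _ d (leqnn _) dj.
by exists (q * D%:~R), d'; split=> // i; rewrite d'E dE mulrA.
Qed.

(** * Independence over the function field of the surface *)

Local Notation P := {mpoly rat[3]}.

Definition PX : P := 'X_i0.
Definition PY : P := 'X_i1.
Definition PZ : P := 'X_i2.

Definition map_forms : 4.-tuple P :=
  [tuple form_u PX PY PZ; form_v PX PY PZ; form_x PX PY PZ;
         (4 / 3) *: form_jac PX PY PZ].

Definition basis_form (r s : 'I_3) : P := PX ^+ r * PY ^+ s * PZ ^+ (4 - r - s).

Definition y_reduced (p : {mpoly rat[4]}) : Prop :=
  forall m, m \in msupp p -> (m iy <= 1)%N.

Lemma big_ord4 (T : Type) (op : T -> T -> T) (idx : T) (F : 'I_4 -> T) :
  \big[op/idx]_(i < 4) F i = op (F iu) (op (F iv) (op (F ix) (op (F iy) idx))).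
Proof.
rewrite !big_ord_recl big_ord0.
by congr (op (F _) (op (F _) (op (F _) (op (F _) _)))); apply: val_inj.
Qed.

Lemma wdegE (m : 'X_{1..4}) : wdeg m = (m iu + m iv + 2 * m ix + 3 * m iy)%N.
Proof. by rewrite /wdeg big_ord4 /weight /=; lia. Qed.

Lemma mdeg_le_wdeg (m : 'X_{1..4}) : (mdeg m <= wdeg m)%N.
Proof.
rewrite mdegE /wdeg leq_sum // => i _; apply: leq_pmulr.
by case: i => -[|[|[|[|]]]].
Qed.

Lemma msize_wdeg (e : nat) (p : {mpoly rat[4]}) :
  p \is e.-homog for wdeg -> (msize p <= e.+1)%N.
Proof.
move=> /dhomogP hp; rewrite msizeE; apply/bigmax_leqP_seq => m mp _.
by rewrite ltnS -(hp m mp); apply: mdeg_le_wdeg.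
Qed.

Lemma map_intr_inj (n : nat) :
  injective (map_mpoly (intr : int -> rat) : {mpoly int[n]} -> {mpoly rat[n]}).
Proof.
move=> p q pq; apply/mpolyP => m; apply: (@intr_inj rat).
by rewrite -!mcoeff_map_mpoly pq.
Qed.

Lemma lead_monomial (R : comNzRingType) (phi : {rmorphism R -> L}) (X Y Z J : R)
    (i j k l r s n a b : nat) :
    phi X = XL -> phi Y = YL -> phi Z = 1 -> lead 0 27 (phi J) ->
    a = (3 * (i + j) + s)%N -> b = (9 * i + 12 * j + 18 * k + 27 * l + r)%N ->
  lead a b (phi (form_u X Y Z ^+ i * (form_v X Y Z ^+ j * (form_x X Y Z ^+ k
                   * ((4 * J) ^+ l * 1))) * (X ^+ r * Y ^+ s * Z ^+ n))).
Proof.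
move=> phiX phiY phiZ leadJ aE bE.
have [phiu phiv phix _] := rmorph_forms phi X Y Z.
have lead_u : lead 3 9 (phi (form_u X Y Z)).
  by rewrite phiu phiX phiY phiZ; exact: lead_form_u.
have lead_v : lead 3 12 (phi (form_v X Y Z)).
  by rewrite phiv phiX phiY phiZ; exact: lead_form_v.
have lead_x : lead 0 18 (phi (form_x X Y Z)).
  by rewrite phix phiX phiY phiZ; exact: lead_form_x.
have lead_4J : lead 0 27 (phi (4 * J)).
  rewrite rmorphM rmorph_nat; refine (leadM (a := 0) (b := 0) _ leadJ).
  exists 4, 4; split=> //; first by rewrite mulr1.
  by rewrite -polyC_natr hornerC -mul_polyC mulr1 polyC_natr.
move: (form_u _ _ _) (form_v _ _ _) (form_x _ _ _) (4 * J) lead_u lead_v lead_x lead_4J.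
move=> x1 x2 x3 x4 l1 l2 l3 l4.
rewrite !(rmorphM, rmorphXn, rmorph1) phiX phiY phiZ expr1n !mulr1.
have -> : a = (3 * i + (3 * j + (0 * k + 0 * l)) + (0 * r + 1 * s))%N by rewrite aE; lia.
have -> : b = (9 * i + (12 * j + (18 * k + 27 * l)) + (1 * r + 0 * s))%N.
  by rewrite bE; lia.
apply: leadM; last exact: (leadM (leadXn _ lead_X) (leadXn _ lead_Y)).
exact: (leadM (leadXn _ l1) (leadM (leadXn _ l2) (leadM (leadXn _ l3) (leadXn _ l4)))).
Qed.

(** Modulo 3 and for Z = 1, the product of X^r Y^s by the value of the monomial
    u^i v^j x^k y^l at [map_forms] has leading monomial Y^(3 (i + j) + s)
    X^(9 e + 3 j + r), where e is the weight.  Together with e and l <= 1, this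
    determines all the exponents. *)
Lemma basis_form_indep (e : nat) (p : 'I_3 -> 'I_3 -> {mpoly rat[4]}) :
    (forall r s, p r s \is e.-homog for wdeg /\ y_reduced (p r s)) ->
    \sum_r \sum_s (p r s \mPo map_forms) * basis_form r s = 0 ->
  forall r s, p r s = 0.
Proof.
move=> hp sum0 r0 s0; apply/eqP/negPn/negP => p_neq0.
pose I : finType := (('I_3 * 'I_3) * 'X_{1..4 < e.+1})%type.
pose c (i : I) : rat := (p i.1.1 i.1.2)@_(i.2).
have cP i : c i != 0 -> wdeg i.2 = e /\ (i.2 iy <= 1)%N.
  rewrite /c -mcoeff_msupp => ci; have [/dhomogP hom red] := hp i.1.1 i.1.2.
  by split; [apply: hom | apply: red].
have ex_c : exists i, c i != 0.
  have [hom _] := hp r0 s0; have := mlead_supp p_neq0; set m := mlead _ => m_in.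
  have mlt : (mdeg m < e.+1)%N.
    by rewrite ltnS -(dhomogP _ _ _ hom m m_in) mdeg_le_wdeg.
  by exists ((r0, s0), BMultinom mlt); rewrite /c /= -mcoeff_msupp.
have [q [d [dE ex_d]]] := primitive_multiple ex_c.
(* The relation is between images of integral forms, whose last coordinate 4 J is
   4 / 3 of [form_jac]. *)
have [J JE] := form_jac_div3.
pose X : {mpoly int[3]} := 'X_i0; pose Y : {mpoly int[3]} := 'X_i1.
pose Z : {mpoly int[3]} := 'X_i2.
pose t := [tuple form_u X Y Z; form_v X Y Z; form_x X Y Z; 4 * J].
pose T (i : I) := (\prod_(k < 4) tnth t k ^+ (i.2 : 'X_{1..4}) k)
                  * (X ^+ i.1.1 * Y ^+ i.1.2 * Z ^+ (4 - i.1.1 - i.1.2)).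
pose to_rat : {rmorphism {mpoly int[3]} -> P} := map_mpoly (intr : int -> rat).
have XE : to_rat X = PX by rewrite /to_rat /= map_mpolyX.
have YE : to_rat Y = PY by rewrite /to_rat /= map_mpolyX.
have ZE : to_rat Z = PZ by rewrite /to_rat /= map_mpolyX.
have [uE vE xE jE] := rmorph_forms to_rat X Y Z.
have tE k : to_rat (tnth t k) = tnth map_forms k.
  case: k => -[|[|[|[|//]]]] ltk; rewrite !(tnth_nth 0) /= -?XE -?YE -?ZE -?uE -?vE -?xE //.
  rewrite rmorphM rmorph_nat -jE JE rmorphM rmorph_nat.
  rewrite -mul_mpolyC mulrA -(mpolyC_nat 3 _ 3) -mpolyCM divfK //.
  by rewrite mpolyC_nat.
have TE i : to_rat (T i) = (\prod_(k < 4) tnth map_forms k ^+ (i.2 : 'X_{1..4}) k)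
                           * basis_form i.1.1 i.1.2.
  rewrite rmorphM rmorph_prod; congr (_ * _).
    by apply: eq_bigr => k _; rewrite rmorphXn tE.
  by rewrite !rmorphM !rmorphXn XE YE ZE.
have {sum0} sum0 : \sum_i (d i)%:~R * T i = 0.
  apply: (map_intr_inj (n := 3)); rewrite -[LHS]/(to_rat _) !raddf0 raddf_sum /=.
  transitivity (q *: \sum_r \sum_s (p r s \mPo map_forms) * basis_form r s); last first.
    by rewrite sum0 scaler0.
  rewrite [X in q *: X]pair_bigA /= scaler_sumr.
  rewrite (eq_bigr (fun rs => \sum_m to_rat ((d (rs, m))%:~R * T (rs, m)))).
    by rewrite pair_bigA; apply: eq_bigr => -[].
  move=> [r s] _ /=; have [hom _] := hp r s.
  rewrite (comp_mpolywE _ (msize_wdeg hom)) mulr_suml scaler_sumr.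
  apply: eq_bigr => m _.
  rewrite -scalerAl scalerA -[q * _](dE ((r, s), m)) [RHS]rmorphM rmorph_int TE.
  by rewrite scaler_int mulrzl.
pose phi : {rmorphism {mpoly int[3]} -> L} :=
  mmap (intr : int -> L) (tnth [tuple XL; YL; 1]).
have phiX : phi X = XL by rewrite /phi /= mmapX mmap1U.
have phiY : phi Y = YL by rewrite /phi /= mmapX mmap1U.
have phiZ : phi Z = 1 by rewrite /phi /= mmapX mmap1U.
have leadJ := lead_jac_div3 phiX phiY phiZ JE.
pose a (i : I) := (3 * ((i.2 : 'X_{1..4}) iu + (i.2 : 'X_{1..4}) iv) + i.1.2)%N.
pose b (i : I) := (9 * (i.2 : 'X_{1..4}) iu + 12 * (i.2 : 'X_{1..4}) iv
  + 18 * (i.2 : 'X_{1..4}) ix + 27 * (i.2 : 'X_{1..4}) iy + i.1.1)%N.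
have leadT i : lead (a i) (b i) (phi (T i)).
  by rewrite /T big_ord4; apply: lead_monomial phiX phiY phiZ leadJ _ _; rewrite /a /b; lia.
clearbody T; suff : \sum_i (d i)%:~R * phi (T i) != 0.
  case/eqP; transitivity (phi (\sum_i (d i)%:~R * T i)); last first.
    exact: etrans (congr1 phi sum0) (raddf0 phi).
  rewrite raddf_sum.
  apply: eq_bigr => i _.
  by rewrite !mulrzl raddfMz.
have d_c i : d i != 0 -> c i != 0.
  by rewrite -(intr_eq0 rat) dE; apply: contraNneq => ->; rewrite mulr0.
apply: (lead_indep (a := a) (b := b)) => // i j /d_c ci /d_c cj [eq_a eq_b].
have [wi yi] := cP i ci; have [wj yj] := cP j cj.
move: eq_a eq_b wi wj yi yj; rewrite !wdegE /a /b.
case: i j {ci cj} => [[r s] m] [[r' s'] m'] /=.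
move: (ltn_ord r) (ltn_ord s) (ltn_ord r') (ltn_ord s').
move=> lr ls lr' ls' eq_a eq_b wi wj yi yj.
have eq_s : s = s' :> nat by lia.
have eq_r : r = r' :> nat by lia.
congr (_, _, _); try exact: val_inj.
have [mu mv mx my] : [/\ m iu = m' iu, m iv = m' iv, m ix = m' ix & m iy = m' iy].
  by split; lia.
apply: val_inj; apply/mnmP => k.
have : [\/ k = iu, k = iv, k = ix | k = iy].
  case: k => -[|[|[|[|//]]]] ltk; [apply: Or41 | apply: Or42 | apply: Or43
    | apply: Or44]; exact: val_inj.
by case=> ->.
Qed.

(** * Forms on the surface *)

Lemma S_eqnE : S_eqn = 'X_iy ^+ 2 - ('X_ix ^+ 3 + coef4 'X_iu 'X_iv * 'X_ix
                                     + (1 / 4)%:MP * coef6 'X_iu 'X_iv).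
Proof. by rewrite /S_eqn -!mul_mpolyC !mpolyC_nat. Qed.

Lemma comp_S_eqn (t : 4.-tuple P) :
  S_eqn \mPo t = t`_3 ^+ 2 - (t`_2 ^+ 3 + coef4 t`_0 t`_1 * t`_2
                              + (1 / 4)%:MP * coef6 t`_0 t`_1).
Proof.
have morphE (phi : {rmorphism {mpoly rat[4]} -> P}) (u v x y c : {mpoly rat[4]}) :
    phi (y ^+ 2 - (x ^+ 3 + coef4 u v * x + c * coef6 u v))
    = phi y ^+ 2 - (phi x ^+ 3 + coef4 (phi u) (phi v) * phi x
                    + phi c * coef6 (phi u) (phi v)).
  by rewrite /coef4 /coef6; ring.
rewrite S_eqnE -[LHS]/((comp_mpoly t : {rmorphism _ -> _}) _) morphE /=.
by rewrite !comp_mpolyXU comp_mpolyC.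
Qed.

Lemma map_forms_on_S : S_eqn \mPo map_forms = 0.
Proof.
set y : P := (4 / 3) *: form_jac PX PY PZ.
have yE : 3 * y = 4 * form_jac PX PY PZ.
  rewrite /y -mul_mpolyC mulrA -(mpolyC_nat 3 _ 3) -mpolyCM mulrCA divff // mulr1.
  by rewrite mpolyC_nat.
have := forms_on_S yE; set u := form_u _ _ _; set v := form_v _ _ _.
set x := form_x _ _ _; move=> E.
have c4 : 4 * (1 / 4)%:MP = 1 :> P by rewrite -(mpolyC_nat 3 _ 4) -mpolyCM mulrCA divff.
have SE : S_eqn \mPo map_forms = y ^+ 2 - (x ^+ 3 + u * v ^+ 2 * (3 * u - v) * x
    + (1 / 4)%:MP * coef6 u v) by rewrite comp_S_eqn.
(* Multiplying by 36 clears the denominators 4 of [S_eqn] and 3 of y. *)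
have nz : 36 != 0 :> P by rewrite -mpolyC_nat mpolyC_eq0 pnatr_eq0.
apply: (mulfI nz); rewrite mulr0 SE mulrBr E /coef4.
transitivity (9 * (1 - 4 * (1 / 4)%:MP) * coef6 u v); last by rewrite c4 subrr; ring.
by move: (coef6 u v) (1 / 4)%:MP => a6 c; ring.
Qed.

Definition cubic_part : {mpoly rat[4]} := 'X_iy ^+ 2 - S_eqn.

Lemma cubic_part_y_free m : m \in msupp cubic_part -> m iy = 0%N.
Proof.
pose free (p : {mpoly rat[4]}) := forall m, m \in msupp p -> m iy = 0%N.
suff : free cubic_part by apply.
have freeD p q : free p -> free q -> free (p + q).
  by move=> hp hq k /msuppD_le; rewrite mem_cat => /orP[/hp|/hq].
have freeN p : free p -> free (- p).
  by move=> hp k; rewrite (perm_mem (msuppN p)); apply: hp.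
have freeM p q : free p -> free q -> free (p * q).
  move=> hp hq k /msuppM_le /allpairsP[[m1 m2] /= [/hp E1 /hq E2 ->]].
  by rewrite mnmDE E1 E2.
have freeC c : free c%:MP.
  by move=> k; rewrite msuppC; case: eqP => // _; rewrite inE => /eqP ->; rewrite mnm0E.
have free_nat n : free n%:R by rewrite -mpolyC_nat; apply: freeC.
have freeX p n : free p -> free (p ^+ n).
  by move=> hp; elim: n => [|n IHn]; [apply: (free_nat 1) | rewrite exprS; apply: freeM].
have freeU i : i != iy -> free 'X_i.
  by move=> /negPf ne_i k; rewrite msuppX inE => /eqP ->; rewrite mnm1E ne_i.
have [fu fv fx] : [/\ free 'X_iu, free 'X_iv & free 'X_ix] by split; apply: freeU.
rewrite /cubic_part S_eqnE opprB addrC subrK /coef4 /coef6; clearbody free.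
by repeat first [exact: fu | exact: fv | exact: fx | exact: free_nat | exact: freeC
  | apply/freeN | apply/freeD | apply/freeX | apply/freeM].
Qed.

(** Division by [S_eqn], which is monic in y. *)
Lemma y_reduction (e : nat) (p : {mpoly rat[4]}) : p \is e.-homog for wdeg ->
  exists q r, [/\ p = q * S_eqn + r, r \is e.-homog for wdeg & y_reduced r].
Proof.
pose red p := exists q r : {mpoly rat[4]},
  [/\ p = q * S_eqn + r, r \is e.-homog for wdeg & y_reduced r].
have red0 : red 0.
  by exists 0, 0; split; rewrite ?mul0r ?addr0 ?dhomog0 // => m; rewrite msupp0.
have redD p1 p2 : red p1 -> red p2 -> red (p1 + p2).
  move=> [q1 [r1 [-> hom1 y1]]] [q2 [r2 [-> hom2 y2]]].
  exists (q1 + q2), (r1 + r2); split; [by ring | exact: rpredD |].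
  by move=> m /msuppD_le; rewrite mem_cat => /orP[/y1|/y2].
have redZ c p1 : red p1 -> red (c *: p1).
  move=> [q1 [r1 [-> hom1 y1]]]; exists (c *: q1), (c *: r1).
  split; [by rewrite scalerDr scalerAl | exact: rpredZ |].
  by move=> m /msuppZ_le /y1.
have red_sum (s : seq 'X_{1..4}) (c : 'X_{1..4} -> rat) (F : 'X_{1..4} -> {mpoly rat[4]}) :
    (forall m, m \in s -> red (F m)) -> red (\sum_(m <- s) c m *: F m).
  move=> hF; rewrite big_seq; elim/big_ind: _ => // m ms.
  exact/redZ/hF.
have hom_y2 : ('X_iy ^+ 2 : {mpoly rat[4]}) \is 6.-homog for wdeg.
  by rewrite mpolyXn dhomogX /= wdegE !mulmnE !mnm1E.
have hom_cubic : cubic_part \is 6.-homog for wdeg by rewrite rpredB ?S_eqn_homog.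
have redX n (m : 'X_{1..4}) : (m iy <= n)%N -> wdeg m = e -> red 'X_[m].
  elim: n m => [|n IHn] m mn we.
    exists 0, 'X_[m]; rewrite mul0r add0r dhomogX /= we eqxx; split=> // k.
    by rewrite msuppX inE => /eqP ->; apply: leq_trans mn _.
  have [m1|m2] := leqP (m iy) 1.
    exists 0, 'X_[m]; rewrite mul0r add0r dhomogX /= we eqxx; split=> // k.
    by rewrite msuppX inE => /eqP ->.
  pose m' := (m - (U_(iy) *+ 2))%MM.
  have mE : m = (m' + (U_(iy) *+ 2))%MM.
    rewrite /m' submK //; apply/mnm_lepP => k; rewrite mulmnE mnm1E.
    by case: eqP => [<-|]; rewrite ?muln1 ?muln0.
  have -> : 'X_[m] = 'X_[m'] * S_eqn
      + \sum_(k <- msupp cubic_part) cubic_part@_k *: 'X_[m' + k].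
    rewrite mE mpolyXD -mpolyXn.
    under eq_bigr do rewrite mpolyXD scalerAr.
    by rewrite -mulr_sumr -mpolyE /cubic_part -mulrDr addrC subrK.
  apply: redD.
    by exists 'X_[m'], 0; rewrite addr0 dhomog0; split=> // k; rewrite msupp0.
  apply: red_sum => k k_in; have yk := cubic_part_y_free k_in.
  have wk := dhomogP _ _ _ hom_cubic k k_in.
  have w2 : wdeg (U_(iy) *+ 2)%MM = 6%N by rewrite wdegE !mulmnE !mnm1E.
  have := congr1 wdeg mE; rewrite wdegD => w'.
  have := congr1 (fun m : 'X_{1..4} => m iy) mE.
  rewrite mnmDE mulmnE mnm1E eqxx => y'.
  apply: IHn; first by rewrite mnmDE yk; lia.
  by rewrite wdegD; have := wk; rewrite /=; lia.
move=> hom; rewrite [p]mpolyE; apply: red_sum => m m_in.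
by apply: redX (leqnn _) _; apply: (dhomogP _ _ _ hom).
Qed.

Lemma S_eqn_mul_vanishes (q : {mpoly rat[4]}) : vanishes_on S_Q (q * S_eqn).
Proof. by move=> a [_ Sa]; rewrite gevalM Sa mulr0. Qed.

(** For forms which are not reduced in y, the coefficients of a relation need only
    be multiples of [S_eqn]. *)
Lemma basis_form_free (e : nat) (p : 'I_3 -> 'I_3 -> {mpoly rat[4]}) :
    (forall r s, p r s \is e.-homog for wdeg) ->
    \sum_r \sum_s (p r s \mPo map_forms) * basis_form r s = 0 ->
  forall r s, p r s \mPo map_forms = 0 /\ vanishes_on S_Q (p r s).
Proof.
move=> hom sum0.
have /fin_all_exists[q /= hq] : forall rs, exists q, exists r,
    [/\ p rs.1 rs.2 = q * S_eqn + r, r \is e.-homog for wdeg & y_reduced r].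
  by move=> rs; apply: y_reduction.
have /fin_all_exists[red /= hred] := hq.
have comp_red r s : p r s \mPo map_forms = red (r, s) \mPo map_forms.
  have [-> _ _] := hred (r, s).
  by rewrite comp_mpolyD rmorphM /= map_forms_on_S mulr0 add0r.
have red0 := basis_form_indep (e := e) (p := fun r s => red (r, s)) _ _.
move=> r s; have /= [pE _ _] := hred (r, s).
have r0 : red (r, s) = 0.
  apply: red0 => [r' s'|]; first by have [] := hred (r', s').
  by rewrite -[RHS]sum0; do 2!apply: eq_bigr => ? _; rewrite comp_red.
by rewrite comp_red r0 rmorph0 pE r0 addr0; split=> //; apply: S_eqn_mul_vanishes.
Qed.

Lemma vanishes_comp0 (e : nat) (p : {mpoly rat[4]}) : p \is e.-homog for wdeg ->
  p \mPo map_forms = 0 -> vanishes_on S_Q p.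
Proof.
move=> hom p0.
have [||//] := basis_form_free (e := e) (p := fun _ _ => p) _ _ ord0 ord0 => //.
by do 2!apply: big1 => ? _; rewrite p0 mul0r.
Qed.

(** * Points of the plane and dominance *)

Lemma kronecker_inj (N : nat) (m m' : 'X_{1..3}) :
    (mdeg m < N)%N -> (mdeg m' < N)%N ->
    (m i0 + m i1 * N + m i2 * N ^ 2 = m' i0 + m' i1 * N + m' i2 * N ^ 2)%N ->
  m = m'.
Proof.
have ltN (k : 'X_{1..3}) i : (mdeg k < N)%N -> (k i < N)%N.
  by apply: leq_ltn_trans; rewrite mdegE (bigD1 i) //= leq_addr.
move=> dm dm' E.
have digits (a b c a' b' c' : nat) : (a < N)%N -> (b < N)%N -> (a' < N)%N -> (b' < N)%N ->
    (a + b * N + c * N ^ 2 = a' + b' * N + c' * N ^ 2)%N -> [/\ a = a', b = b' & c = c'].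
  move=> aN bN aN' bN'; have N_gt0 : (0 < N)%N by apply: leq_ltn_trans aN.
  have step x y x' y' : (x < N)%N -> (x' < N)%N -> (x + y * N = x' + y' * N)%N ->
      x = x' /\ y = y'.
    move=> xN xN' xy; split.
      by move: (congr1 (modn^~ N) xy); rewrite ![(_ + _ * N)%N]addnC !modnMDl !modn_small.
    move: (congr1 (divn^~ N) xy).
    by rewrite ![(_ + _ * N)%N]addnC !divnMDl // !divn_small // !addn0.
  rewrite -!addnA -!mulnn !mulnA -!mulnDl => /(step _ _ _ _ aN aN')[-> {}E].
  by have [-> ->] := step _ _ _ _ bN bN' E.
have [e0 e1 e2] := digits _ _ _ _ _ _ (ltN m i0 dm) (ltN m i1 dm) (ltN m' i0 dm')
  (ltN m' i1 dm') E.
apply/mnmP => k; have : [\/ k = i0, k = i1 | k = i2].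
  by case: k => -[|[|[|//]]] ltk; [apply: Or31 | apply: Or32 | apply: Or33]; apply: val_inj.
by case=> ->.
Qed.

(** A polynomial function determines its polynomial: Kronecker substitution
    reduces this to one variable. *)
Lemma mpoly3_eval_eq0 (q : {mpoly algC[3]}) : (forall a, q.@[a] = 0) -> q = 0.
Proof.
move=> q0; pose N := msize q.
pose x (i : 'I_3) : {poly algC} := 'X^(N ^ i).
pose s : {poly algC} := \sum_(m <- msupp q) q@_m *: 'X^(m i0 + m i1 * N + m i2 * N ^ 2).
have s0 : s = 0.
  apply: (@roots_geq_poly_eq0 _ s [seq k%:R | k <- iota 0 (size s)]).
  - apply/allP => _ /mapP[k _ ->]; apply/rootP.
    rewrite -[RHS](q0 (fun i => k%:R ^+ (N ^ i))) mevalE /s horner_sum.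
    apply: eq_bigr => m _; rewrite hornerZ hornerXn; congr (_ * _).
    rewrite !big_ord_recl big_ord0 mulr1 -!exprM -!exprD /=.
    congr (_ ^+ _); rewrite expn0 expn1 mul1n [(N * _)%N]mulnC [(N ^ _ * _)%N]mulnC addnA.
    by congr (m _ + m _ * N + m _ * N ^ 2)%N; apply: val_inj.
  - by rewrite map_inj_uniq ?iota_uniq //; apply: (mulrIn (oner_neq0 _)).
  - by rewrite size_map size_iota.
apply/mpolyP => m; rewrite mcoeff0; apply/eqP/negPn/negP; rewrite -mcoeff_msupp => m_in.
move: (m_in); rewrite mcoeff_msupp => /eqP; apply.
transitivity (s`_(m i0 + m i1 * N + m i2 * N ^ 2)); last by rewrite s0 coef0.
rewrite /s coef_sum (bigD1_seq m) ?msupp_uniq //= coefZ coefXn eqxx mulr1.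
rewrite big_seq_cond big1 ?addr0 // => k /andP[k_in ne_k].
rewrite coefZ coefXn; case: eqP => [E|]; last by rewrite mulr0.
by move/eqP: ne_k => []; apply: (kronecker_inj (N := N)) => //; apply: msize_mdeg_lt.
Qed.

Lemma geval_eq0 (q : P) : (forall a, geval q a = 0) -> q = 0.
Proof.
move=> q0; have /mpolyP E := mpoly3_eval_eq0 q0; apply/mpolyP => m.
by apply: (fmorph_inj (ratr : rat -> algC)); rewrite -mcoeff_map_mpoly E !mcoeff0 rmorph0.
Qed.

Lemma geval_comp (t : 4.-tuple P) (G : {mpoly rat[4]}) (a : 'I_3 -> algC) :
  geval (G \mPo t) a = geval G (fun i => geval (tnth t i) a).
Proof.
have ev n (b : 'I_n -> algC) :
    {f : {rmorphism {mpoly rat[n]} -> algC} | forall p, f p = geval p b}.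
  by exists (meval b \o map_mpoly (ratr : rat -> algC))%FUN.
have [f fE] := ev 3 a; have [g gE] := ev 4 (fun i => geval (tnth t i) a).
rewrite -fE -gE comp_mpolyEX [in RHS](mpolyE G) !rmorph_sum /=; apply: eq_bigr => m _.
rewrite fE gE !gevalZ comp_mpolyX -[geval _ a]fE rmorph_prod.
rewrite /geval map_mpolyX mevalX; congr (_ * _).
by apply: eq_bigr => i _; rewrite rmorphXn fE.
Qed.

Lemma map_forms_homog i : tnth map_forms i \is (15 * weight i).-homog.
Proof.
pose Q d m (p : P) := p \is (3 * d + m).-homog.
have Q1 : Q 0%N 0%N 1 by apply: dhomog1.
have QN d m p : Q d m p -> Q d m (- p) by rewrite /Q rpredN.
have QD d m p q : Q d m p -> Q d m q -> Q d m (p + q) by apply: rpredD.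
have QM d m d' m' p q : Q d m p -> Q d' m' q -> Q (d + d')%N (m + m')%N (p * q).
  by move=> /dhomogM hp /hp; rewrite /Q mulnDr addnACA.
have QX : Q 0%N 1%N PX by rewrite /Q dhomogX /= mdeg1.
have QY : Q 0%N 1%N PY by rewrite /Q dhomogX /= mdeg1.
have QZ : Q 0%N 1%N PZ by rewrite /Q dhomogX /= mdeg1.
have hM k l n (p q : P) : p \is k.-homog -> q \is l.-homog -> (k + l)%N = n ->
    p * q \is n.-homog by move=> hp hq <-; apply: dhomogM.
have hE k l n (p : P) : p \is k.-homog -> (k * n)%N = l -> p ^+ n \is l.-homog.
  by move=> hp <-; apply: dhomogMn.
have QF : Q 1%N 0%N (cusp_F PX PY PZ).
  by apply: rpredB; [apply: (hM _ _ _ _ _ (hE _ 2 _ _ QY _) QZ) | apply: (hE _ _ _ _ QX)].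
have QG : Q 1%N 0%N (cusp_G PX PY PZ).
  apply: rpredB; last by apply: (hM _ _ _ _ _ QY (hE _ 2 _ _ QZ _)).
  apply: rpredD; last by apply: (hM _ _ _ _ _ QX (hE _ 2 _ _ QY _)).
  by apply: rpredD; [apply: (hE _ _ _ _ QY) | apply: (hE _ _ _ _ QZ)].
case: i => -[|[|[|[|//]]]] lti; rewrite (tnth_nth 0) /= /weight /=.
- exact: (bigraded_form_u Q1 QN QD QM QF QG QX QY QZ).
- exact: (bigraded_form_v Q1 QN QD QM QF QG QX QY QZ).
- exact: (bigraded_form_x Q1 QN QD QM QF QG QX QY QZ).
- exact/rpredZ/(bigraded_form_jac Q1 QN QD QM QF QG QX QY QZ).
Qed.

Lemma form_u_neq0 : form_u PX PY PZ != 0.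
Proof.
apply/eqP => u0.
pose p (r s : 'I_3) : {mpoly rat[4]} := 'X_iu.
have p0 : p ord0 ord0 = 0.
  apply: (basis_form_indep (e := 1)) => [r s|].
    rewrite dhomogX /= wdegE !mnm1E; split=> // m.
    by rewrite msuppX inE => /eqP ->; rewrite mnm1E.
  by do 2!apply: big1 => ? _; rewrite comp_mpolyXU /= u0 mul0r.
have /eqP := congr1 (fun q => q@_U_(iu)) p0.
by rewrite mcoeffXU eqxx mcoeff0 oner_eq0.
Qed.

Lemma map_forms_nonzero : exists i, tnth map_forms i != 0.
Proof. by exists iu; rewrite (tnth_nth 0) form_u_neq0. Qed.

Definition covering_map : ratmap S_Q :=
  @RatMap S_Q map_forms 15 map_forms_homog map_forms_nonzero map_forms_on_S.

Lemma comp0_of_points (G : {mpoly rat[4]}) :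
    (forall a, (exists i, rm_at covering_map a i != 0) ->
      geval G (rm_at covering_map a) = 0) ->
  G \mPo map_forms = 0.
Proof.
move=> G0; have : (G \mPo map_forms) * form_u PX PY PZ == 0.
  apply/eqP/geval_eq0 => a; rewrite gevalM geval_comp.
  have [u0|u0] := eqVneq (geval (form_u PX PY PZ) a) 0; first by rewrite u0 mulr0.
  by rewrite [X in X * _]G0 ?mul0r //; exists iu; rewrite /rm_at (tnth_nth 0).
by rewrite mulf_eq0 (negPf form_u_neq0) orbF => /eqP.
Qed.

Lemma comp0_of_vanishes (G : {mpoly rat[4]}) : vanishes_on S_Q G -> G \mPo map_forms = 0.
Proof.
move=> G0; apply: comp0_of_points => a a_neq0; apply: G0; split=> //.
by rewrite -geval_comp map_forms_on_S /geval !rmorph0.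
Qed.

Lemma covering_map_dominant : dominant covering_map.
Proof. by move=> e G homG /comp0_of_points; apply: vanishes_comp0 homG. Qed.

(** * Counting dimensions *)

Lemma linear_relation (J T : finType) (A : J -> T -> rat) (w : T -> P) :
    (#|T| < #|J|)%N ->
  exists2 c : J -> rat, (exists j, c j != 0) &
    \sum_j c j *: (\sum_x A j x *: w x) = 0.
Proof.
move=> ltTJ.
pose B := \matrix_(i < #|J|, x < #|T|) A (enum_val i) (enum_val x).
have /rowV0Pn[c cB c0] : kermx B != 0.
  rewrite kermx_eq0 /row_free neq_ltn; apply/orP; left.
  exact: leq_ltn_trans (rank_leq_col B) ltTJ.
have {}cB : c *m B = 0 by apply/eqP; rewrite -sub_kermx.
exists (fun j => c 0 (enum_rank j)).
  have [i ci] : exists i, c 0 i != 0.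
    apply/existsP; rewrite -negb_forall; apply: contraNN c0 => /forallP c0.
    by apply/eqP/rowP => i; rewrite mxE; apply/eqP.
  by exists (enum_val i); rewrite enum_valK.
under eq_bigr do rewrite scaler_sumr; rewrite exchange_big big1 //= => x _.
under eq_bigr do rewrite scalerA; rewrite -scaler_suml (reindex _ (onW_bij _ (enum_val_bij J))).
have := congr1 (fun v : 'rV_ _ => v 0 (enum_rank x)) cB; rewrite !mxE => E.
rewrite (eq_bigr (fun i => c 0 i * B i (enum_rank x))); first by rewrite E scale0r.
by move=> i _; rewrite /= enum_valK mxE enum_rankK.
Qed.

Section Filtration.

Let F := cusp_F PX PY PZ.
Let G := cusp_G PX PY PZ.

Definition span_index (D M : nat) : finType := ('I_D.+1 * ('I_3 * 'I_M.+1))%type.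

Definition span_form (D M : nat) (x : span_index D M) : P :=
  if (x.2.1 + x.2.2 <= M)%N then
    G ^+ (D - x.1) * F ^+ x.1 * (PX ^+ x.2.1 * PY ^+ x.2.2 * PZ ^+ (M - x.2.1 - x.2.2))
  else 0.

(** Up to a power of G, the forms of degree D in F, G and M in the coordinates
    belong to the span of those of degree at most 2 in X: the equation of the curve
    of parameter (G : - F) is cubic in X, with leading coefficient - G. *)
Definition span (D M : nat) (p : P) : Prop :=
  exists c : span_index D M -> rat, p = \sum_x c x *: span_form x.

Lemma span_add D M p q : span D M p -> span D M q -> span D M (p + q).
Proof.
move=> [c ->] [c' ->]; exists (fun x => c x + c' x); rewrite -big_split.
by apply: eq_bigr => x _; rewrite scalerDl.
Qed.

Lemma span_scale D M a p : span D M p -> span D M (a *: p).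
Proof.
move=> [c ->]; exists (fun x => a * c x); rewrite scaler_sumr.
by apply: eq_bigr => x _; rewrite scalerA.
Qed.

Lemma span0 D M : span D M 0.
Proof. by exists (fun=> 0); rewrite big1 // => x _; rewrite scale0r. Qed.

Lemma span_opp D M p : span D M p -> span D M (- p).
Proof. by move=> hp; rewrite -scaleN1r; apply: span_scale. Qed.

Lemma span_gen D M i j k : (i <= D)%N -> (j <= 2)%N -> (j + k <= M)%N ->
  span D M (G ^+ (D - i) * F ^+ i * (PX ^+ j * PY ^+ k * PZ ^+ (M - j - k))).
Proof.
move=> iD j2 jkM; have kM : (k < M.+1)%N by rewrite ltnS (leq_trans _ jkM) ?leq_addl.
have iD' : (i < D.+1)%N by rewrite ltnS.
have j2' : (j < 3)%N by rewrite ltnS.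
pose x : span_index D M := (Ordinal iD', (Ordinal j2', Ordinal kM)).
exists (fun y => (y == x)%:R); rewrite (bigD1 x) //= eqxx scale1r big1 ?addr0 => [|y].
  by rewrite /span_form /= jkM.
by move/negPf => ->; rewrite scale0r.
Qed.

Lemma span_mul D M D' M' r :
    (forall i j k, (i <= D)%N -> (j <= 2)%N -> (j + k <= M)%N ->
      span D' M' (r * (G ^+ (D - i) * F ^+ i
                       * (PX ^+ j * PY ^+ k * PZ ^+ (M - j - k))))) ->
  forall p, span D M p -> span D' M' (r * p).
Proof.
move=> hr p [c ->]; rewrite mulr_sumr.
elim/big_ind: _ => [|p1 p2|[i [j k]] _]; [exact: span0 | exact: span_add |].
rewrite -scalerAr; apply: span_scale; rewrite /span_form /=.
case: ifP => [jkM|_]; last by rewrite mulr0; apply: span0.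
by apply: hr; rewrite ?(ltn_ord i) // -ltnS.
Qed.

Lemma span_G D M p : span D M p -> span D.+1 M (G * p).
Proof.
apply: span_mul => i j k iD j2 jkM; rewrite !mulrA -exprS -subSn // -!mulrA.
by rewrite [_ ^+ j * _]mulrA mulrA; apply: span_gen => //; apply: leqW.
Qed.

Lemma span_F D M p : span D M p -> span D.+1 M (F * p).
Proof.
apply: span_mul => i j k iD j2 jkM; rewrite mulrA [F * _]mulrCA -exprS -subSS.
exact: span_gen.
Qed.

Lemma span_Y D M p : span D M p -> span D M.+1 (PY * p).
Proof.
apply: span_mul => i j k iD j2 jkM; have /= := @span_gen D M.+1 i j k.+1 iD j2.
by rewrite addnS ltnS => /(_ jkM); rewrite subSn ?subSS ?exprS //; [congr span; ring | lia].
Qed.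

Lemma span_Z D M p : span D M p -> span D M.+1 (PZ * p).
Proof.
apply: span_mul => i j k iD j2 jkM; have /= := @span_gen D M.+1 i j k iD j2 (leqW jkM).
have -> : (M.+1 - j - k)%N = (M - j - k).+1 by lia.
by rewrite exprS; congr span; ring.
Qed.

Lemma span_GX D M p : span D M p -> span D.+1 M.+1 (G * PX * p).
Proof.
apply: span_mul => i j k iD j2 jkM; have [j1|j1] := leqP j 1.
  have /= := @span_gen D.+1 M.+1 i j.+1 k (leqW iD) j1 jkM.
  rewrite subSn // subSS [G ^+ _.+1]exprS [PX ^+ _.+1]exprS.
  by congr span; ring.
have {j2 j1} j2 : j = 2 by lia.
subst j; set l := (M - 2 - k)%N.
have -> : G * PX * (G ^+ (D - i) * F ^+ i * (PX ^+ 2 * PY ^+ k * PZ ^+ l))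
    = G ^+ (D - i).+1 * F ^+ i * (PX ^+ 0 * PY ^+ k.+2 * PZ ^+ l.+1)
    - G ^+ (D - i) * F ^+ i.+1 * (PX ^+ 0 * PY ^+ k.+3 * PZ ^+ l)
    - G ^+ (D - i) * F ^+ i.+1 * (PX ^+ 0 * PY ^+ k * PZ ^+ l.+3)
    - G ^+ (D - i) * F ^+ i.+1 * (PX ^+ 1 * PY ^+ k.+2 * PZ ^+ l)
    + G ^+ (D - i) * F ^+ i.+1 * (PX ^+ 0 * PY ^+ k.+1 * PZ ^+ l.+2).
  rewrite !exprS !expr0; move: (G ^+ _) (F ^+ _) (PY ^+ _) (PZ ^+ _) => Gi Fi Yk Zl.
  by rewrite /F /G /cusp_F /cusp_G; ring.
have gen i' j' k' l' : (i' <= D.+1)%N -> (j' <= 2)%N -> (j' + k' <= M.+1)%N ->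
    l' = (M.+1 - j' - k')%N ->
    span D.+1 M.+1 (G ^+ (D.+1 - i') * F ^+ i' * (PX ^+ j' * PY ^+ k' * PZ ^+ l')).
  by move=> iD' jk' jM' ->; apply: span_gen.
rewrite -subSn // -[(D - i)%N]subSS.
by do !apply: span_add; try apply: span_opp; apply: gen; rewrite /l; lia.
Qed.
End Filtration.

(** Multiplication by r has bidegree (d, m) for [span], up to a power of G, which is
    independent of D and M: it does not affect the leading terms of the count. *)
Definition tame (d m : nat) (r : P) : Prop :=
  exists delta, forall D M p, span D M p ->
    span (D + d + delta) (M + m) (cusp_G PX PY PZ ^+ delta * (r * p)).

Lemma span_Gn n D M p : span D M p -> span (D + n) M (cusp_G PX PY PZ ^+ n * p).
Proof.
move=> hp; elim: n => [|n IHn]; first by rewrite addn0 mul1r.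
by rewrite addnS exprS -mulrA; apply: span_G.
Qed.

Lemma span_NFn n D M p : span D M p -> span (D + n) M ((- cusp_F PX PY PZ) ^+ n * p).
Proof.
move=> hp; elim: n => [|n IHn]; first by rewrite addn0 mul1r.
by rewrite addnS exprS -mulrA mulNr; apply/span_opp/span_F.
Qed.

Lemma span_cast D M D' M' p : D = D' -> M = M' -> span D M p -> span D' M' p.
Proof. by move=> -> ->. Qed.

Lemma tameC c : tame 0 0 c%:MP.
Proof.
by exists 0 => D M p hp; rewrite !addn0 mul1r mul_mpolyC; apply: span_scale.
Qed.

Lemma tameN d m r : tame d m r -> tame d m (- r).
Proof.
by move=> [k hr]; exists k => D M p /hr; rewrite mulNr mulrN; apply: span_opp.
Qed.

Lemma tame_delta d m r delta :
    (forall D M p, span D M p ->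
      span (D + d + delta) (M + m) (cusp_G PX PY PZ ^+ delta * (r * p))) ->
  forall delta', (delta <= delta')%N -> forall D M p, span D M p ->
    span (D + d + delta') (M + m) (cusp_G PX PY PZ ^+ delta' * (r * p)).
Proof.
move=> hr delta' le_delta D M p /hr /(span_Gn (delta' - delta)).
by rewrite -addnA subnKC // mulrA -exprD subnK.
Qed.

Lemma tameD d m r s : tame d m r -> tame d m s -> tame d m (r + s).
Proof.
move=> [k hr] [l hs]; exists (maxn k l) => D M p hp.
rewrite mulrDl mulrDr; apply: span_add.
  exact: (tame_delta hr (leq_maxl k l)).
exact: (tame_delta hs (leq_maxr k l)).
Qed.

Lemma tameM d m d' m' r s : tame d m r -> tame d' m' s -> tame (d + d') (m + m') (r * s).
Proof.
move=> [k hr] [l hs]; exists (k + l)%N => D M p /hs /hr hp.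
move: hp; set G := cusp_G _ _ _; set a := (_ * _); set b := (_ * _).
by have -> : a = b; [rewrite /a /b exprD; ring | apply: span_cast; lia].
Qed.

Lemma tameX d m n r : tame d m r -> tame (d * n) (m * n) (r ^+ n).
Proof.
move=> hr; elim: n => [|n IHn]; first by rewrite !muln0 expr0 -mpolyC1; apply: tameC.
by rewrite !mulnS exprS; apply: tameM.
Qed.

Lemma tame_G : tame 1 0 (cusp_G PX PY PZ).
Proof. by exists 0 => D M p /span_G; rewrite !addn0 addn1 mul1r. Qed.

Lemma tame_F : tame 1 0 (cusp_F PX PY PZ).
Proof. by exists 0 => D M p /span_F; rewrite !addn0 addn1 mul1r. Qed.

Lemma tame_X : tame 0 1 PX.
Proof. by exists 1 => D M p /span_GX; rewrite addn0 !addn1 expr1 mulrA. Qed.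

Lemma tame_Y : tame 0 1 PY.
Proof. by exists 0 => D M p /span_Y; rewrite !addn0 addn1 mul1r. Qed.

Lemma tame_Z : tame 0 1 PZ.
Proof. by exists 0 => D M p /span_Z; rewrite !addn0 addn1 mul1r. Qed.

Lemma tame_homog c (p : P) : p \is c.-homog -> tame 0 c p.
Proof.
move=> /dhomogP hom; rewrite [p]mpolyE big_seq.
elim/big_ind: _ => [|q r|m m_in]; [|exact: tameD|].
  by exists 0 => D M q _; rewrite mul0r mulr0; apply: span0.
rewrite -mul_mpolyC -[c]add0n -(hom m m_in); apply: (tameM (d := 0) (d' := 0)).
  exact: tameC.
rewrite mpolyXE_id !big_ord_recl big_ord0 mulr1 /= mdegE !big_ord_recl big_ord0 addn0.
have E0 : ord0 = i0 :> 'I_3 by apply: val_inj.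
have E1 : lift ord0 ord0 = i1 :> 'I_3 by apply: val_inj.
have E2 : lift ord0 (lift ord0 ord0) = i2 :> 'I_3 by apply: val_inj.
rewrite E2 E1 E0; have := tameM (tameX (m i1) tame_Y) (tameX (m i2) tame_Z).
by move/(tameM (tameX (m i0) tame_X)); rewrite !mul0n !mul1n.
Qed.

Lemma tame_forms : [/\ tame 4 3 (form_u PX PY PZ), tame 4 3 (form_v PX PY PZ),
  tame 8 6 (form_x PX PY PZ) & tame 12 9 ((4 / 3) *: form_jac PX PY PZ)].
Proof.
have tame1 : tame 0 0 1 by rewrite -mpolyC1; apply: tameC.
have [tF tG] := (tame_F, tame_G); have [[tX tY] tZ] := (tame_X, tame_Y, tame_Z).
split.
- exact: (bigraded_form_u tame1 tameN tameD tameM tF tG tX tY tZ).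
- exact: (bigraded_form_v tame1 tameN tameD tameM tF tG tX tY tZ).
- exact: (bigraded_form_x tame1 tameN tameD tameM tF tG tX tY tZ).
rewrite -mul_mpolyC; apply: (tameM (tameC _) (m := 0) (d := 0)).
exact: (bigraded_form_jac tame1 tameN tameD tameM tF tG tX tY tZ).
Qed.

(** A function x^k y^l, with pole of order 2 k + 3 l <= N along the zero section,
    times a monomial of degree D in u, v, as a form of weight D + N. *)
Definition pole_mon (D N j k l : nat) : 'X_{1..4} :=
  [multinom nth 0%N [:: D - j + (N - 2 * k - 3 * l); j; k; l]%N i | i < 4].

(** The factor [hess]^D common to all the values would cost 3 D in the degree in
    X, Y, Z; it is removed before counting. *)
Lemma pole_mon_comp D N j k l : (j <= D)%N ->
  let h := hess (cusp_G PX PY PZ) (- cusp_F PX PY PZ) PX PY PZ in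
  'X_[pole_mon D N j k l] \mPo map_forms
  = (2 * h) ^+ D * (cusp_G PX PY PZ ^+ (D - j) * ((- cusp_F PX PY PZ) ^+ j
    * (form_u PX PY PZ ^+ (N - 2 * k - 3 * l) * form_x PX PY PZ ^+ k
       * ((4 / 3) *: form_jac PX PY PZ) ^+ l))).
Proof.
move=> jD h.
have uvE : form_u PX PY PZ ^+ (D - j) * form_v PX PY PZ ^+ j
    = (2 * h) ^+ D * (cusp_G PX PY PZ ^+ (D - j) * (- cusp_F PX PY PZ) ^+ j).
  have -> : form_u PX PY PZ = 2 * h * cusp_G PX PY PZ by rewrite mulrAC.
  have -> : form_v PX PY PZ = 2 * h * - cusp_F PX PY PZ.
    by rewrite /form_v -/h; move: (cusp_F _ _ _) h => F h'; ring.
  by move: (2 * h) => H; rewrite !exprMn mulrACA -exprD subnK.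
rewrite comp_mpolyX big_ord4 !mnmE -[tnth _ iu]/(form_u PX PY PZ).
rewrite -[tnth _ iv]/(form_v PX PY PZ) -[tnth _ ix]/(form_x PX PY PZ).
rewrite -[tnth _ iy]/((4 / 3) *: form_jac PX PY PZ) [nth _ _ iu]/= [nth _ _ iv]/=.
rewrite [nth _ _ ix]/= [nth _ _ iy]/=; move: uvE.
move: (form_u _ _ _) (form_v _ _ _) (form_x _ _ _) (_ *: form_jac _ _ _).
move: (cusp_G _ _ _) (- cusp_F _ _ _) ((2 * h) ^+ D) => G F H u v x y uvE.
rewrite exprD mulr1; transitivity (u ^+ (D - j) * v ^+ j
  * (u ^+ (N - 2 * k - 3 * l) * x ^+ k * y ^+ l)); first by ring.
by rewrite uvE; ring.
Qed.

(** With D large, there are about 10 N D products of the 10 forms by the monomials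
    [pole_mon]; without their common factor and up to a fixed power of G they lie
    in [span (D + O(1)) (3 N + c)], of dimension about 3 (3 N + c) D. *)
Lemma ten_forms_dependent (c : nat) (q : 'I_10 -> P) : (forall s, q s \is c.-homog) ->
  exists e (p : 'I_10 -> {mpoly rat[4]}),
    [/\ forall s, p s \is e.-homog for wdeg /\ y_reduced (p s),
        exists s, p s != 0 & \sum_s (p s \mPo map_forms) * q s = 0].
Proof.
(* For pole orders 2 k + 3 l with k <= n and l <= 1 there are 2 (n + 1) = N - 1
   functions; n is such that 10 (N - 1) > 3 (3 N + c + 1). *)
move=> hom_q; pose n := (3 * c + 6)%N; pose N := (2 * n + 3)%N; pose M := (3 * N + c)%N.
pose I1 : finType := ('I_10 * ('I_2 * 'I_n.+1))%type.
have [tu _ tx ty] := tame_forms.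
pose R (y : I1) : P := form_u PX PY PZ ^+ (N - 2 * y.2.2 - 3 * y.2.1)
  * form_x PX PY PZ ^+ y.2.2 * ((4 / 3) *: form_jac PX PY PZ) ^+ y.2.1 * q y.1.
have /fin_all_exists[delta hdelta] (y : I1) : exists delta, forall D M p, span D M p ->
    span (D + 4 * N + delta) (M + (3 * N + c))
         (cusp_G PX PY PZ ^+ delta * (R y * p)).
  have [l1 kn] : ((y.2.1 <= 1) /\ (y.2.2 <= n))%N.
    by split; rewrite -ltnS ltn_ord.
  have := tameM (tameM (tameM (tameX (N - 2 * y.2.2 - 3 * y.2.1) tu) (tameX y.2.2 tx))
    (tameX y.2.1 ty)) (tame_homog (hom_q y.1)).
  case=> delta h; exists delta => D M' p /h; apply: span_cast; rewrite /N; lia.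
pose del := \max_y delta y.
pose D' := (4 * N + del)%N; pose D := (3 * M.+1 * D')%N.
pose J : finType := (I1 * 'I_D.+1)%type.
pose v (x : J) : P := cusp_G PX PY PZ ^+ (D - x.2) * ((- cusp_F PX PY PZ) ^+ x.2
  * (cusp_G PX PY PZ ^+ del * R x.1)).
have span1 : span 0 0 1.
  by have := @span_gen 0 0 0 0 0 isT isT isT; rewrite !expr0 !mulr1.
have /fin_all_exists[A hA] (x : J) : exists A : span_index (D + D') M -> rat,
    v x = \sum_z A z *: span_form z.
  have jD : (x.2 <= D)%N by rewrite -ltnS.
  have := tame_delta (hdelta x.1) (leq_bigmax x.1) span1; rewrite mulr1 -/del.
  move/(span_NFn x.2)/(span_Gn (D - x.2)); apply: span_cast; rewrite /D' /M; lia.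
have [|a a_neq0 rel] := linear_relation A (@span_form (D + D') M).
  rewrite !card_prod !card_ord.
  have : (D.+1 = 3 * M.+1 * D' + 1)%N by rewrite /D; lia.
  rewrite -addSn; move=> ->; have : (3 * M.+1 + 1 <= 10 * (2 * n.+1))%N.
    by rewrite /M /N /n; lia.
  move: (3 * M.+1)%N => K; nia.
have {}rel : \sum_x a x *: v x = 0 by rewrite -[RHS]rel; apply: eq_bigr => x _; rewrite hA.
pose mon (x : J) := pole_mon D N x.2 x.1.2.2 x.1.2.1.
pose p (s : 'I_10) : {mpoly rat[4]} := \sum_(x : J | x.1.1 == s) a x *: 'X_[mon x].
have mon_y x : (mon x iy <= 1)%N by rewrite mnmE /= -ltnS.
have wmon x : wdeg (mon x) = (D + N)%N.
  have weightE (D0 j k l : nat) : (j < D0.+1)%N -> (k < n.+1)%N -> (l < 2)%N ->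
      (D0 - j + (N - 2 * k - 3 * l) + j + 2 * k + 3 * l = D0 + N)%N by rewrite /N; lia.
  by rewrite wdegE !mnmE /=; apply: weightE; apply: ltn_ord.
have mon_inj x y : x.1.1 = y.1.1 -> mon x = mon y -> x = y.
  case: x y => [[s [l k]] j] [[s' [l' k']] j'] /= -> E.
  have := congr1 (fun m : 'X_{1..4} => (m iv, m ix, m iy)) E.
  by rewrite !mnmE /= => -[/val_inj -> /val_inj -> /val_inj ->].
exists (D + N)%N, p; split.
- move=> s; split.
    by apply: rpred_sum => x _; apply: rpredZ; rewrite dhomogX /= wmon.
  move=> m; rewrite /p; elim/big_ind: _ => [|p1 p2 h1 h2|x _].
  + by rewrite msupp0.
  + by move/msuppD_le; rewrite mem_cat => /orP[/h1|/h2].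
  + by move/msuppZ_le; rewrite msuppX inE => /eqP ->.
- have [x ax] := a_neq0; exists x.1.1.
  apply: contraNneq ax => px0; have := congr1 (fun r => r@_(mon x)) px0.
  rewrite mcoeff0 raddf_sum (bigD1 x) //= mcoeffZ mcoeffX eqxx mulr1.
  rewrite big1 ?addr0 => [->//|y /andP[/eqP xy ne_yx]]; rewrite mcoeffZ mcoeffX.
  by case: eqP => [/(mon_inj _ _ xy) E|]; rewrite ?mulr0 // E eqxx in ne_yx *.
have G_neq0 : cusp_G PX PY PZ != 0.
  by apply: contraNneq form_u_neq0 => G0; rewrite /form_u G0 mulr0 mul0r.
apply: (mulfI (expf_neq0 del G_neq0)); rewrite mulr0.
set h := hess (cusp_G PX PY PZ) (- cusp_F PX PY PZ) PX PY PZ.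
transitivity ((2 * h) ^+ D * \sum_x a x *: v x); last by rewrite rel mulr0.
rewrite mulr_sumr mulr_sumr (partition_big (fun x : J => x.1.1) predT) //=.
apply: eq_bigr => s _; rewrite raddf_sum mulr_suml mulr_sumr.
apply: eq_bigr => x /eqP xs.
have jD : (x.2 <= D)%N by rewrite -ltnS.
rewrite /= comp_mpolyZ pole_mon_comp // -/h -scalerAl -!scalerAr; congr (_ *: _).
rewrite /v /R xs.
have shuffle (Gd H Gj Fj r t : P) :
  Gd * (H * (Gj * (Fj * r)) * t) = H * (Gj * (Fj * (Gd * (r * t)))) by ring.
exact: shuffle.
Qed.

(** * The degree *)

(* From here on only the established properties of these forms matter. *)
#[local] Opaque map_forms.

Local Notation frac := (@FracField.tofrac P).

Lemma reduced_comp_eq0 (e : nat) (p : {mpoly rat[4]}) :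
    p \is e.-homog for wdeg -> y_reduced p -> p \mPo map_forms = 0 ->
  p = 0.
Proof.
move=> hom red p0; apply: (basis_form_indep (e := e) (p := fun _ _ => p)) ord0 ord0 => //.
by do 2!apply: big1 => ? _; rewrite p0 mul0r.
Qed.

Lemma comp_map_formsM (p q : {mpoly rat[4]}) :
  (p * q) \mPo map_forms = (p \mPo map_forms) * (q \mPo map_forms).
Proof. exact: rmorphM. Qed.

Lemma nonvanishing_comp (e : nat) (p : {mpoly rat[4]}) : p \is e.-homog for wdeg ->
  ~ vanishes_on S_Q p <-> p \mPo map_forms != 0.
Proof.
move=> hom; split=> [nv|/eqP p_neq0 /comp0_of_vanishes //].
by apply/eqP => /(vanishes_comp0 hom).
Qed.

Lemma ord9_pairs : exists g : 'I_9 -> 'I_3 * 'I_3, bijective g.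
Proof.
have E : 9 = #|{: 'I_3 * 'I_3}| by rewrite card_prod !card_ord.
exists (enum_val \o cast_ord E); apply: bij_comp; first exact: enum_val_bij.
by exists (cast_ord (esym E)); [exact: cast_ordK | exact: cast_ordKV].
Qed.

Lemma basis_form_homog (rs : 'I_3 * 'I_3) : basis_form rs.1 rs.2 \is 4.-homog.
Proof.
have XE i n : ('X_i : P) ^+ n \is n.-homog.
  by have := dhomogMn n (_ : 'X_i \is 1.-homog); rewrite mul1n; apply; rewrite dhomogX /= mdeg1.
have := dhomogM (dhomogM (XE i0 rs.1) (XE i1 rs.2)) (XE i2 (4 - rs.1 - rs.2)%N).
have -> : (rs.1 + rs.2 + (4 - rs.1 - rs.2) = 4)%N by have := ltn_ord rs.1; have := ltn_ord rs.2; lia.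
by [].
Qed.

Lemma PZ_neq0 : PZ != 0.
Proof. by rewrite -msupp_eq0 msuppX. Qed.

Lemma pullback_sub z1 z2 : pullback_funfield covering_map z1 ->
  pullback_funfield covering_map z2 -> pullback_funfield covering_map (z1 - z2).
Proof.
move=> [e1 [G1 [H1 [hG1 hH1 nv1 ->]]]] [e2 [G2 [H2 [hG2 hH2 nv2 ->]]]].
have H1_neq0 := (nonvanishing_comp hH1).1 nv1.
have H2_neq0 := (nonvanishing_comp hH2).1 nv2.
have hH := dhomogM hH1 hH2.
exists (e1 + e2)%N, (G1 * H2 - H1 * G2), (H1 * H2); split=> //.
- by apply: rpredB; apply: dhomogM.
- by apply/(nonvanishing_comp hH); rewrite comp_map_formsM mulf_neq0.
rewrite [rm_forms _]/= comp_mpolyB !comp_map_formsM tofracB !tofracM.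
have subE (E : fieldType) (g1 h1 g2 h2 : E) : h1 != 0 -> h2 != 0 ->
  g1 / h1 - g2 / h2 = (g1 * h2 - h1 * g2) / (h1 * h2) by move=> *; field; apply/andP.
by apply: subE; rewrite tofrac_eq0.
Qed.

Lemma prod_homog (I : finType) (Q : pred I) (e : I -> nat) (H : I -> {mpoly rat[4]}) :
    (forall i, H i \is (e i).-homog for wdeg) ->
  \prod_(i | Q i) H i \is (\sum_(i | Q i) e i).-homog for wdeg.
Proof.
move=> hH; elim/big_rec2: _ => [|i n p _ hp]; first exact: dhomog1.
exact: dhomogM.
Qed.

Section Degree.

Variable g : 'I_9 -> 'I_3 * 'I_3.
Hypothesis g_bij : bijective g.

Definition degree_basis (i : 'I_9) : {fraction P} :=
  frac (basis_form (g i).1 (g i).2) / frac (PZ ^+ 4).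

Lemma sum_basis_pairs (p : 'I_9 -> P) (g' : 'I_3 * 'I_3 -> 'I_9) : cancel g g' ->
  \sum_i p i * basis_form (g i).1 (g i).2
  = \sum_r \sum_s p (g' (r, s)) * basis_form r s.
Proof.
move=> gK; rewrite pair_bigA (reindex g) /=; last exact: onW_bij.
by apply: eq_bigr => i _; rewrite -surjective_pairing gK.
Qed.

Lemma degree_basis_free (d : 'I_9 -> {fraction P}) :
    (forall i, pullback_funfield covering_map (d i)) ->
    \sum_i d i * degree_basis i = 0 ->
  forall i, d i = 0.
Proof.
move=> /fin_all_exists[e /fin_all_exists[G /fin_all_exists[H hd]]] sum0.
have hG i : G i \is (e i).-homog for wdeg by have [] := hd i.
have hH i : H i \is (e i).-homog for wdeg by have [] := hd i.
have H_neq0 i : H i \mPo map_forms != 0.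
  by have [_ _ nv _] := hd i; apply/(nonvanishing_comp (hH i)).
pose Q i := G i * \prod_(j | j != i) H j.
pose D := frac (\prod_j (H j \mPo map_forms)).
have D_neq0 : D != 0 by rewrite tofrac_eq0; apply/prodf_neq0 => i _; apply: H_neq0.
have QE i : frac (Q i \mPo map_forms) = d i * D.
  have [_ _ _ ->] := hd i; rewrite /Q /D [rm_forms _]/= comp_map_formsM.
  rewrite (rmorph_prod (comp_mpoly map_forms)) [in RHS](bigD1 i) //= !tofracM.
  have mulE (E : fieldType) (a h b : E) : h != 0 -> a * b = a / h * (h * b).
    by move=> h_neq0; rewrite mulrA divfK.
  by apply: mulE; rewrite tofrac_eq0.
have homQ i : Q i \is (\sum_j e j).-homog for wdeg.
  by rewrite (bigD1 i) //=; apply: dhomogM => //; apply: prod_homog.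
have relQ : \sum_i (Q i \mPo map_forms) * basis_form (g i).1 (g i).2 = 0.
  apply/eqP; rewrite -tofrac_eq0 rmorph_sum /=; apply/eqP.
  transitivity (D * frac (PZ ^+ 4) * \sum_i d i * degree_basis i); last first.
    by rewrite sum0 mulr0.
  rewrite mulr_sumr; apply: eq_bigr => i _; rewrite tofracM QE /degree_basis.
  have mulE (E : fieldType) (x y b z4 : E) : z4 != 0 ->
    x * y * b = y * z4 * (x * (b / z4)) by move=> *; field.
  by apply: mulE; rewrite tofrac_eq0 expf_neq0 ?PZ_neq0.
have [g' gK g'K] := g_bij; move: relQ; rewrite (sum_basis_pairs _ gK) => relQ i.
have := basis_form_free (p := fun r s => Q (g' (r, s))) (fun r s => homQ _) relQ.
move=> /(_ (g i).1 (g i).2)[]; rewrite -surjective_pairing gK => Q0 _.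
by apply: (mulIf D_neq0); rewrite -QE Q0 tofrac0 mul0r.
Qed.

(** The 9 basis elements and z are dependent, and the coefficient of z in a relation
    is not 0 because the basis is free. *)
Lemma degree_basis_span z : funfield_P2 z -> exists c : {ffun 'I_9 -> {fraction P}},
  (forall i, pullback_funfield covering_map (c i)) /\ z = \sum_i c i * degree_basis i.
Proof.
move=> [e [a [b [hom_a hom_b b_neq0 ->]]]].
pose q (s : 'I_10) : P :=
  if s == ord_max then a * PZ ^+ 4
  else b * basis_form (g (inord s)).1 (g (inord s)).2.
have hom_q s : q s \is (e + 4).-homog.
  rewrite /q; case: ifP => _; apply: dhomogM => //; last exact: basis_form_homog.
  by have := dhomogMn 4 (_ : 'X_i2 \is 1.-homog); apply; rewrite dhomogX /= mdeg1.
have [w [p [hom_p [s ps_neq0]]]] := ten_forms_dependent hom_q.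
rewrite big_ord_recr /= {2}/q eqxx.
pose t (i : 'I_9) := p (widen_ord (leqnSn 9) i).
rewrite (eq_bigr (fun i => b * ((t i \mPo map_forms) * basis_form (g i).1 (g i).2)));
  last first.
  move=> i _; rewrite /q ifN; last by rewrite neq_ltn /= ltn_ord.
  by rewrite mulrCA inord_val.
rewrite -mulr_sumr => rel.
have last_neq0 : p ord_max \mPo map_forms != 0.
  apply: contraNneq ps_neq0 => pm0.
  have pm : p ord_max = 0.
    by have [hom red] := hom_p ord_max; exact: reduced_comp_eq0 hom red pm0.
  have {rel} /eqP : b * (\sum_i (t i \mPo map_forms) * basis_form (g i).1 (g i).2) = 0.
    by rewrite -[RHS]rel pm0 mul0r addr0.
  rewrite mulf_eq0 (negPf b_neq0) /=; have [g' gK g'K] := g_bij.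
  rewrite (sum_basis_pairs _ gK) => /eqP.
  move/(basis_form_indep (p := fun r s => t (g' (r, s))) (fun r s => hom_p _)) => t0.
  have [->|s_neq] := eqVneq s ord_max; first by rewrite pm.
  have s9 : (s < 9)%N by rewrite ltn_neqAle -ltnS ltn_ord andbT.
  have -> : s = widen_ord (leqnSn 9) (Ordinal s9) by apply: val_inj.
  have := t0 (g (Ordinal s9)).1 (g (Ordinal s9)).2.
  by rewrite -surjective_pairing gK /t => ->.
have [homm _] := hom_p ord_max.
exists [ffun i => frac (- t i \mPo map_forms) / frac (p ord_max \mPo map_forms)]; split.
  move=> i; rewrite ffunE; exists w, (- t i), (p ord_max); split=> //.
  - by rewrite rpredN; have [] := hom_p (widen_ord (leqnSn 9) i).
  - exact/(nonvanishing_comp homm).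
pose T := frac (\sum_i (t i \mPo map_forms) * basis_form (g i).1 (g i).2).
have TE : frac b * T + frac (p ord_max \mPo map_forms) * (frac a * frac (PZ ^+ 4)) = 0.
  by rewrite -!tofracM -tofracD rel tofrac0.
have sumE : \sum_i [ffun i => frac (- t i \mPo map_forms)
    / frac (p ord_max \mPo map_forms)] i * degree_basis i
    = - (T / (frac (p ord_max \mPo map_forms) * frac (PZ ^+ 4))).
  have -> : T = \sum_i frac ((t i \mPo map_forms) * basis_form (g i).1 (g i).2).
    by rewrite /T rmorph_sum.
  rewrite mulr_suml -sumrN; apply: eq_bigr => i _.
  rewrite ffunE comp_mpolyN tofracN tofracM /degree_basis invfM.
  have mulE (E : fieldType) (x y l z4 : E) : - x / l * (y / z4) = - (x * y * (l^-1 * z4^-1)).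
    by rewrite !mulNr mulrACA.
  exact: mulE.
have solve (E : fieldType) (x y l u z4 : E) : x != 0 -> l != 0 -> z4 != 0 ->
    x * y + l * (u * z4) = 0 -> u / x = - (y / (l * z4)).
  move=> x0 l0 z0 E0; have -> : y = - (l * (u * z4)) / x.
    by apply: (mulfI x0); rewrite [RHS]mulrC divfK //; apply/eqP; rewrite -addr_eq0 E0.
  by field; rewrite ?x0 ?l0 ?z0.
by rewrite sumE; apply: solve TE; rewrite tofrac_eq0 // expf_neq0 ?PZ_neq0.
Qed.

End Degree.

Theorem theorem1p4 :
  exists f : ratmap S_Q, dominant f /\ ratmap_degree f 9.
Proof.
exists covering_map; split; first exact: covering_map_dominant.
have [g g_bij] := ord9_pairs; exists (degree_basis g); split=> [i|z /(degree_basis_span g_bij)].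
  exists 4, (basis_form (g i).1 (g i).2), (PZ ^+ 4); split=> //.
  - exact: basis_form_homog.
  - by have := dhomogMn 4 (_ : 'X_i2 \is 1.-homog); apply; rewrite dhomogX /= mdeg1.
  - by rewrite expf_neq0 ?PZ_neq0.
move=> [c [hc zE]]; exists c; split=> // c' [hc' zE'].
apply/ffunP => i; apply/eqP; rewrite -subr_eq0; apply/eqP.
apply: (degree_basis_free g_bij (d := fun i => c i - c' i)) => [j|].
  exact: pullback_sub.
under eq_bigr do rewrite mulrBl.
by rewrite sumrB -zE -zE' subrr.
Qed.
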